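(* Let $d_1,d_2,c_1,c_2,c_3$ be nonnegative integers and $k$ an integer with $0\le k\le \min(d_2,c_2)$. (In exponents and indices $k$ is this integer; as a base it is the generator $k$.) Then on $\mathcal{O}(U_q(3))$ $$\mathbf h\left((k^* )^{d_1+k}(h^* )^{d_2-k}a^{c_1}b^{c_2-k}c^{c_3+k}(c^* )^{c_3}(b^* )^{c_2}(a^* )^{c_1}h^{d_2}k^{d_1}\right)$$ $$=(-1)^kq^{2d_1d_2+2c_1c_2+2c_1c_3+2c_2c_3+2c_2+4c_3+k(d_2+c_2-k+1)}\,\frac{(1-q^2)^2(1-q^4)(q^2;q^2)_{d_2}(q^2;q^2)_{c_2}}{(q^2;q^2)_{d_1+d_2+1}(q^2;q^2)_{c_1+c_2+c_3+1}}$$ $$\times\sum_{j=0}^{c_3}\frac{(-1)^{j}q^{j^2-j}\binom{d_1}{j}_{q^{2}}\binom{c_3}{j}_{q^2}(q^2;q^2)_{j}}{(q^{2d_1+2d_2+2c_1+2c_3-2j+4};q^2)_{c_2+1}}\sum_{i=0}^{c_2-k}q^{(2d_1+2d_2+2c_3-2j+2)i}(q^2;q^2)_{c_1+i}(q^2;q^2)_{d_1+c_2+c_3-j-i}\binom{c_2-k}{i}_{q^2}.$$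
   Context: Let $q$ be real, $q\notin\{0,1,-1\}$. $\mathcal{O}(Mat_q(3))$ is the unital associative $\mathbb{C}$-algebra generated by $x_{i,j}$, $1\le i,j\le 3$, with relations, for $i<l$ and $j<k$: $x_{i,j}x_{l,j}=q\,x_{l,j}x_{i,j}$, $x_{i,j}x_{i,k}=q\,x_{i,k}x_{i,j}$, $x_{i,k}x_{l,j}=x_{l,j}x_{i,k}$, $x_{i,j}x_{l,k}=x_{l,k}x_{i,j}+(q-q^{-1})x_{i,k}x_{l,j}$, with algebra homomorphisms $\Delta(x_{i,j})=\sum_{p}x_{i,p}\otimes x_{p,j}$, $\varepsilon(x_{i,j})=\delta_{i,j}$. For $I=\{i_1<\dots<i_r\}$, $J=\{j_1<\dots<j_r\}$ put $\xi^I_J=\sum_{\tau\in\mathfrak S_r}(-q)^{\ell(\tau)}x_{i_1,j_{\tau(1)}}\cdots x_{i_r,j_{\tau(r)}}$ ($\ell$ = number of inversions); $D_q=\xi^{\{1,2,3\}}_{\{1,2,3\}}$ is central. Adjoin a central inverse $\mathrm{det}_q^{-1}$ of $D_q$ with $\Delta(\mathrm{det}_q^{-1})=\mathrm{det}_q^{-1}\otimes\mathrm{det}_q^{-1}$ to obtain the Hopf algebra $\mathcal{O}(GL_q(3))$. $\mathcal{O}(U_q(3))$ is this algebra with the conjugate-linear anti-multiplicative involution $x_{i,j}^*=(-q)^{j-i}\xi_{\hat j}^{\hat i}\,\mathrm{det}_q^{-1}$, $D_q^*=\mathrm{det}_q^{-1}$, where $\hat p=\{1,2,3\}\setminus\{p\}$.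 The Haar state $\mathbf h$ is the unique linear functional with $\mathbf h(1)=1$ and $(\mathrm{id}\otimes \mathbf h)\Delta(x)=\mathbf h(x)1=(\mathbf h\otimes\mathrm{id})\Delta(x)$ for all $x$. Generators are renamed $\begin{bmatrix} x_{1,1} & x_{1,2} & x_{1,3} \\ x_{2,1} & x_{2,2} & x_{2,3} \\ x_{3,1} & x_{3,2} & x_{3,3} \end{bmatrix}=\begin{bmatrix} a & b & c \\ d & e & f \\ g & h & k \end{bmatrix}$ (the Haar state is boldface to distinguish it from the generator $h$). Notation: $(x;p)_N=\prod_{i=0}^{N-1}(1-xp^i)$, $(x;p)_0=1$; $\binom{N}{j}_{q^2}=\frac{(q^2;q^2)_N}{(q^2;q^2)_j(q^2;q^2)_{N-j}}$ for $0\le j\le N$ and $0$ for other integers $j$. *)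

(* Defs.v *)
From HB Require Import structures.
From mathcomp Require Import all_boot all_order all_algebra perm.
From mathcomp Require Import finmap monalg.
From mathcomp Require Import boolp reals complex.

Set Implicit Arguments.
Unset Strict Implicit.
Unset Printing Implicit Defensive.

Import Order.TTheory GRing.Theory Num.Theory.
Local Open Scope ring_scope.
Local Open Scope quotient_scope.

Section ModuleQuotient.
Variables (K : comNzRingType) (V : lmodType K) (S : V -> Prop).

Inductive span : V -> Prop :=
| span0 : span 0
| spanZD c s x : S s -> span x -> span (c *: s + x).

Lemma spanD x y : span x -> span y -> span (x + y).
Proof.
by move=> sx sy; elim: sx => [|c s {}x Ss _ ih]; rewrite ?add0r // -addrA; constructor.
Qed.

Lemma spanZ c x : span x -> span (c *: x).
Proof.
elim=> [|d s {}x Ss _ ih]; first by rewrite scaler0; constructor.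
by rewrite scalerDr scalerA; constructor.
Qed.

Lemma span_mem s : S s -> span s.
Proof. by move=> Ss; rewrite -[s]addr0 -{1}[s]scale1r; apply: spanZD Ss span0. Qed.

Definition span_pred : {pred V} := fun x => `[< span x >].

Lemma span_predP x : reflect (span x) (x \in span_pred).
Proof. exact: asboolP. Qed.

Lemma span_zmod_closed : zmod_closed span_pred.
Proof.
split=> [|x y /span_predP sx /span_predP sy]; first exact/span_predP/span0.
by apply/span_predP/spanD=> //; rewrite -scaleN1r; apply: spanZ.
Qed.

HB.instance Definition _ := GRing.isZmodClosed.Build V span_pred span_zmod_closed.

Definition qmod : Type := Quotient.quot span_pred.
HB.instance Definition _ := Choice.on qmod.
HB.instance Definition _ := GRing.Zmodule.on qmod.

End ModuleQuotient.

HB.lock Definition qpi (K : comNzRingType) (V : lmodType K) (S : V -> Prop)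
  (x : V) : qmod S := \pi_(Quotient.quot (span_pred S)) x.
HB.lock Definition qrepr (K : comNzRingType) (V : lmodType K) (S : V -> Prop)
  (t : qmod S) : V := repr (t : Quotient.quot (span_pred S)).

Arguments qpi {K V} S x.
Arguments qrepr {K V S} t.

Section ModuleQuotientTheory.
Variables (K : comNzRingType) (V : lmodType K) (S : V -> Prop).
Local Notation qpi := (qpi S).
Local Notation qrepr := (@qrepr K V S).
Local Notation qmod := (qmod S).
Local Notation span := (span S).

Lemma qreprK : cancel qrepr qpi.
Proof. by move=> t; rewrite qpi.unlock qrepr.unlock reprK. Qed.

Lemma qpiP x y : qpi x = qpi y <-> span (x - y).
Proof.
rewrite qpi.unlock; split=> [e | /(span_predP S)].
  by apply/span_predP; rewrite Quotient.idealrBE; apply/eqP.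
by rewrite Quotient.idealrBE => /eqP.
Qed.

Lemma qpi_rel s : S s -> qpi s = 0.
Proof.
move=> Ss; rewrite (_ : 0 = qpi 0); last by rewrite qpi.unlock !piE.
by apply/qpiP; rewrite subr0; apply: span_mem.
Qed.

Lemma qpi_additive : {morph qpi : x y / x - y}.
Proof. by move=> x y; rewrite qpi.unlock !piE. Qed.

Fact qscale_key : unit. Proof. by []. Qed.
Definition qscale : K -> qmod -> qmod :=
  locked_with qscale_key (fun c t => qpi (c *: qrepr t)).

Lemma qscale_pi c x : qscale c (qpi x) = qpi (c *: x).
Proof. by rewrite /qscale unlock; apply/qpiP; rewrite -scalerBr; apply/spanZ/qpiP; rewrite qreprK. Qed.

Lemma qpiD : {morph qpi : x y / x + y}.
Proof. by move=> x y; rewrite qpi.unlock !piE. Qed.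

Fact qscaleA c d t : qscale c (qscale d t) = qscale (c * d) t.
Proof. by rewrite -(qreprK t) !qscale_pi scalerA. Qed.
Fact qscale1 : left_id 1 qscale.
Proof. by move=> t; rewrite -(qreprK t) !qscale_pi scale1r. Qed.
Fact qscaleDr : right_distributive qscale +%R.
Proof.
by move=> c t u; rewrite -(qreprK t) -(qreprK u) -qpiD !qscale_pi -qpiD scalerDr.
Qed.
Fact qscaleDl t : {morph qscale^~ t : c d / c + d}.
Proof. by move=> c d; rewrite -(qreprK t) !qscale_pi -qpiD scalerDl. Qed.

HB.instance Definition _ :=
  GRing.Zmodule_isLmodule.Build K qmod qscaleA qscale1 qscaleDr qscaleDl.

Lemma qpi_linear : linear qpi.
Proof. by move=> c x y; rewrite qpiD -qscale_pi. Qed.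
HB.instance Definition _ := GRing.isLinear.Build K V qmod *:%R qpi qpi_linear.

(* Only meaningful when [f] is linear and vanishes on [S]; see [qliftE]. *)
Definition qlift (W : lmodType K) (f : V -> W) (t : qmod) : W := f (qrepr t).

Section Lift.
Variables (W : lmodType K) (f : {linear V -> W}).
Hypothesis fS : forall s, S s -> f s = 0.

Lemma qliftE x : qlift f (qpi x) = f x.
Proof.
apply/eqP; rewrite -subr_eq0 -linearB.
have /qpiP : qpi (qrepr (qpi x)) = qpi x by rewrite qreprK.
elim=> [|c s y Ss _ /eqP ih]; first by rewrite linear0.
by rewrite linearD linearZ /= ih fS // scaler0 addr0.
Qed.

Lemma qlift_linear : linear (qlift f).
Proof.
move=> c t u; rewrite -(qreprK t) -(qreprK u) -linearP !qliftE.
by rewrite linearP.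
Qed.
End Lift.

End ModuleQuotientTheory.

Section AlgebraQuotient.
Variables (K : comNzRingType) (F : algType K) (S : F -> Prop).

Definition ideal_mem (x : F) : Prop :=
  exists u s v, S s /\ x = u * s * v.

Definition qalg : Type := qmod ideal_mem.
HB.instance Definition _ := GRing.Lmodule.on qalg.

Definition qalg_pi : F -> qalg := @qpi K F ideal_mem.
HB.instance Definition _ := GRing.Linear.on qalg_pi.

Lemma ideal_mulr x y : span ideal_mem x -> span ideal_mem (x * y).
Proof.
elim=> [|c _ {}x [u [s [v [Ss ->]]]] _ ih]; first by rewrite mul0r; constructor.
rewrite mulrDl -scalerAl; constructor=> //.
by exists u, s, (v * y); rewrite !mulrA.
Qed.

Lemma ideal_mull x y : span ideal_mem x -> span ideal_mem (y * x).
Proof.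
elim=> [|c _ {}x [u [s [v [Ss ->]]]] _ ih]; first by rewrite mulr0; constructor.
rewrite mulrDr -scalerAr; constructor=> //.
by exists (y * u), s, v; rewrite !mulrA.
Qed.

Fact qmul_key : unit. Proof. by []. Qed.
Definition qmul : qalg -> qalg -> qalg :=
  locked_with qmul_key (fun t u => qalg_pi (qrepr t * qrepr u)).

Lemma qmul_pi x y : qmul (qalg_pi x) (qalg_pi y) = qalg_pi (x * y).
Proof.
rewrite /qmul unlock.
apply/qpiP; set x' := qrepr _; set y' := qrepr _.
have -> : x' * y' - x * y = (x' - x) * y' + x * (y' - y).
  by rewrite mulrBl mulrBr addrA subrK.
by apply: spanD; [apply: ideal_mulr | apply: ideal_mull]; apply/qpiP; apply: qreprK.
Qed.

Lemma qalg_piK t : exists x, t = qalg_pi x.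
Proof. by exists (qrepr t); rewrite /qalg_pi qreprK. Qed.

Fact qmulA : associative qmul.
Proof.
move=> t u v; have [x ->] := qalg_piK t; have [y ->] := qalg_piK u.
by have [z ->] := qalg_piK v; rewrite !qmul_pi mulrA.
Qed.
Fact qmul1l : left_id (qalg_pi 1) qmul.
Proof. by move=> t; have [x ->] := qalg_piK t; rewrite qmul_pi mul1r. Qed.
Fact qmul1r : right_id (qalg_pi 1) qmul.
Proof. by move=> t; have [x ->] := qalg_piK t; rewrite qmul_pi mulr1. Qed.
Fact qmulDl : left_distributive qmul +%R.
Proof.
move=> t u v; have [x ->] := qalg_piK t; have [y ->] := qalg_piK u.
by have [z ->] := qalg_piK v; rewrite -linearD !qmul_pi -linearD mulrDl.
Qed.
Fact qmulDr : right_distributive qmul +%R.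
Proof.
move=> t u v; have [x ->] := qalg_piK t; have [y ->] := qalg_piK u.
by have [z ->] := qalg_piK v; rewrite -linearD !qmul_pi -linearD mulrDr.
Qed.

HB.instance Definition _ := GRing.Zmodule_isPzRing.Build qalg
  qmulA qmul1l qmul1r qmulDl qmulDr.

Lemma qalg_pi_monoid : monoid_morphism qalg_pi.
Proof. by split=> // x y; rewrite -qmul_pi. Qed.
HB.instance Definition _ :=
  GRing.isMonoidMorphism.Build F qalg qalg_pi qalg_pi_monoid.

Lemma qalg_scaleAl (c : K) (t u : qalg) : c *: (t * u) = (c *: t : qalg) * u.
Proof.
have [x ->] := qalg_piK t; have [y ->] := qalg_piK u.
by rewrite -rmorphM -!linearZ -rmorphM /= scalerAl.
Qed.

Lemma qalg_scaleAr (c : K) (t u : qalg) : c *: (t * u) = t * (c *: u : qalg).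
Proof.
have [x ->] := qalg_piK t; have [y ->] := qalg_piK u.
by rewrite -rmorphM -!linearZ -rmorphM /= scalerAr.
Qed.

Lemma qalg_rel s : S s -> qalg_pi s = 0.
Proof. by move=> Ss; apply: qpi_rel; exists 1, s, 1; rewrite mul1r mulr1. Qed.

End AlgebraQuotient.

Lemma linear_fun0Z (K : comNzRingType) (V W : lmodType K) (f : V -> W) :
  linear f -> f 0 = 0 /\ forall c x, f (c *: x) = c *: f x.
Proof.
move=> lf; have f0 : f 0 = 0.
  by have := lf (-1) 0 0; rewrite scaler0 addr0 scaleN1r addNr.
by split=> // c x; have := lf c x 0; rewrite f0 !addr0.
Qed.

Section TensorModule.
Variables (K : comNzRingType) (A B : lmodType K).

Local Notation free := {malg K[(A * B)%type]}.

Inductive tensor_rel : free -> Prop :=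
| tensor_relDl a a' b : tensor_rel (<< (a + a', b) >> - << (a, b) >> - << (a', b) >>)
| tensor_relDr a b b' : tensor_rel (<< (a, b + b') >> - << (a, b) >> - << (a, b') >>)
| tensor_relZl c a b : tensor_rel (<< (c *: a, b) >> - c *: << (a, b) >>)
| tensor_relZr c a b : tensor_rel (<< (a, c *: b) >> - c *: << (a, b) >>).

Definition tensor : Type := qmod tensor_rel.
HB.instance Definition _ := GRing.Lmodule.on tensor.

End TensorModule.

HB.lock Definition tens (K : comNzRingType) (A B : lmodType K) (a : A) (b : B) :
  tensor A B := qpi (@tensor_rel K A B) << (a, b) >>.

(* Only meaningful when [f] is bilinear; see [tens_liftE]. *)
HB.lock Definition tens_lift (K : comNzRingType) (A B W : lmodType K)
    (f : A -> B -> W) : tensor A B -> W :=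
  qlift (fun g : {malg K[(A * B)%type]} => \sum_(k <- msupp g) g@_k *: f k.1 k.2).

Arguments tens {K A B} a b.
Arguments tens_lift {K A B W} f t.

Section TensorModuleTheory.
Variables (K : comNzRingType) (A B : lmodType K).
Local Notation tensor := (tensor A B).
Local Notation free := {malg K[(A * B)%type]}.

Lemma tens_linear_l (b : B) : linear (fun a : A => tens a b).
Proof.
move=> c a a'; rewrite tens.unlock.
have /qpi_rel/eqP := tensor_relDl (c *: a) a' b.
rewrite !linearB /= -addrA -opprD subr_eq0 => /eqP ->; congr (_ + _).
have /qpi_rel/eqP := tensor_relZl c a b.
by rewrite linearB linearZ /= subr_eq0 => /eqP.
Qed.

Lemma tens_linear_r (a : A) : linear (fun b : B => tens a b).
Proof.
move=> c b b'; rewrite tens.unlock.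
have /qpi_rel/eqP := tensor_relDr a (c *: b) b'.
rewrite !linearB /= -addrA -opprD subr_eq0 => /eqP ->; congr (_ + _).
have /qpi_rel/eqP := tensor_relZr c a b.
by rewrite linearB linearZ /= subr_eq0 => /eqP.
Qed.

Lemma malg_scaleU c (k : (A * B)%type) : << c *g k >> = c *: << k >> :> free.
Proof. by apply/malgP => k'; rewrite mcoeffZ !mcoeffU mulrnAr mulr1. Qed.

Lemma tensor_ind (P : tensor -> Prop) :
  P 0 -> (forall c a b t, P t -> P (c *: tens a b + t)) -> forall t, P t.
Proof.
move=> P0 PD t; rewrite -(qreprK t) [qrepr t]monalgE; set g := qrepr t.
elim: (finmap.enum_fset _) => [|[a b] s ih]; first by rewrite big_nil linear0.
rewrite big_cons malg_scaleU linearD linearZ.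
by have := PD g@_(a, b) a b _ ih; rewrite tens.unlock.
Qed.

Section Lift.
Variable W : lmodType K.

Definition free_lift (f : A -> B -> W) (g : free) : W :=
  \sum_(k <- msupp g) g@_k *: f k.1 k.2.

Lemma free_liftEw f (d : {fset (A * B)%type}) (g : free) :
  (msupp g `<=` d)%fset -> free_lift f g = \sum_(k <- d) g@_k *: f k.1 k.2.
Proof.
move=> le; rewrite /free_lift (big_fset_incl _ le) //= => k _ /mcoeff_outdom ->.
by rewrite scale0r.
Qed.

Lemma free_lift_linear f : linear (free_lift f).
Proof.
move=> c x y; pose d := (msupp x `|` msupp y)%fset.
rewrite !(@free_liftEw f d) ?fsubsetUl ?fsubsetUr //; last first.
  by apply: fsubset_trans (msuppD_le _ _) _; rewrite fsetSU // msuppZ_le.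
rewrite scaler_sumr -big_split /=; apply: eq_bigr => k _.
by rewrite mcoeffD mcoeffZ scalerDl scalerA.
Qed.
HB.instance Definition _ f :=
  GRing.isLinear.Build K free W *:%R (free_lift f) (free_lift_linear f).

Lemma free_liftU f a b : free_lift f << (a, b) >> = f a b.
Proof. by rewrite (free_liftEw _ msuppU_le) big_seq_fset1 mcoeffUU scale1r. Qed.

Variable f : A -> B -> W.
Hypotheses (fl : forall b, linear (f^~ b)) (fr : forall a, linear (f a)).

Lemma free_lift_rel s : tensor_rel s -> free_lift f s = 0.
Proof.
case=> [a a' b|a b b'|c a b|c a b]; rewrite !linearB ?linearZ /= !free_liftU.
- by have := fl b 1 a a'; rewrite !scale1r => ->; rewrite [_ + f a' b]addrC addrK subrr.
- by have := fr a 1 b b'; rewrite !scale1r => ->; rewrite [_ + f a b']addrC addrK subrr.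
- by have [_ ->] := linear_fun0Z (fl b); rewrite -scalerDr subrr scaler0.
- by have [_ ->] := linear_fun0Z (fr a); rewrite -scalerDr subrr scaler0.
Qed.

Lemma tens_liftE a b : tens_lift f (tens a b) = f a b.
Proof. by rewrite tens_lift.unlock tens.unlock (qliftE free_lift_rel) /= free_liftU. Qed.

Lemma tens_lift_linear : linear (tens_lift f).
Proof. by rewrite tens_lift.unlock; apply: (qlift_linear free_lift_rel). Qed.

End Lift.
End TensorModuleTheory.

Lemma tensor_linear_ext (K : comNzRingType) (A B V : lmodType K)
    (f g : tensor A B -> V) : linear f -> linear g ->
  (forall a b, f (tens a b) = g (tens a b)) -> f =1 g.
Proof.
move=> lf lg e; elim/tensor_ind=> [|c a b t ih]; last by rewrite lf lg ih e.
by have [-> _] := linear_fun0Z lf; have [-> _] := linear_fun0Z lg.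
Qed.

Lemma tensor_linear_param (K : comNzRingType) (A B V X : lmodType K)
    (g : X -> tensor A B -> V) : (forall x, linear (g x)) ->
  (forall a b, linear (fun x => g x (tens a b))) -> forall t, linear (fun x => g x t).
Proof.
move=> gl gx; elim/tensor_ind=> [|d a b t ih] c x y /=.
  have g0 z : g z 0 = 0 by have [] := linear_fun0Z (gl z).
  by rewrite !g0 scaler0 addr0.
have gD z : g z (d *: tens a b + t) = d *: g z (tens a b) + g z t by rewrite gl.
rewrite !gD gx ih !scalerDr !scalerA [d * c]mulrC.
by rewrite -!addrA; congr (_ + _); rewrite addrCA.
Qed.

Section TensorAlgebra.
Variables (K : comNzRingType) (A B : algType K).

Fact tens_mul_key : unit. Proof. by []. Qed.
Definition tens_mul : tensor A B -> tensor A B -> tensor A B :=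
  locked_with tens_mul_key (fun t u =>
    tens_lift (fun a b => tens_lift (fun a' b' => tens (a * a') (b * b')) u) t).

Let tens_mul_def t u : tens_mul t u =
  tens_lift (fun a b => tens_lift (fun a' b' => tens (a * a') (b * b')) u) t.
Proof. by rewrite /tens_mul unlock. Qed.

Let mulA a b a' b' : tensor A B := tens (a * a') (b * b').

Let mul_l a b b' : linear (fun a' => mulA a b a' b').
Proof. by move=> c x y; rewrite /mulA mulrDr -scalerAr tens_linear_l. Qed.
Let mul_r a b a' : linear (mulA a b a').
Proof. by move=> c x y; rewrite /mulA mulrDr -scalerAr tens_linear_r. Qed.

Let mul1_l u b : linear (fun a => tens_lift (mulA a b) u).
Proof.
apply: (@tensor_linear_param _ _ _ _ _ (fun a => tens_lift (mulA a b))) => [a|a' b'].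
  exact: (tens_lift_linear (mul_l a b) (mul_r a b)).
move=> c x y; rewrite (tens_liftE (mul_l _ _) (mul_r _ _)).
rewrite (tens_liftE (mul_l x b) (mul_r x b)) (tens_liftE (mul_l y b) (mul_r y b)).
by rewrite /mulA mulrDl -scalerAl tens_linear_l.
Qed.

Let mul1_r u a : linear (fun b => tens_lift (mulA a b) u).
Proof.
apply: (@tensor_linear_param _ _ _ _ _ (fun b => tens_lift (mulA a b))) => [b|a' b'].
  exact: (tens_lift_linear (mul_l a b) (mul_r a b)).
move=> c x y; rewrite (tens_liftE (mul_l _ _) (mul_r _ _)).
rewrite (tens_liftE (mul_l a x) (mul_r a x)) (tens_liftE (mul_l a y) (mul_r a y)).
by rewrite /mulA mulrDl -scalerAl tens_linear_r.
Qed.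

Let tens_mul_tens a b u : tens_mul (tens a b) u = tens_lift (mulA a b) u.
Proof. by rewrite tens_mul_def (tens_liftE (mul1_l u) (mul1_r u)). Qed.

Lemma tens_mulE a b a' b' :
  tens_mul (tens a b) (tens a' b') = tens (a * a') (b * b').
Proof. by rewrite tens_mul_tens (tens_liftE (mul_l a b) (mul_r a b)). Qed.

Lemma tens_mul_linear_l u : linear (tens_mul^~ u).
Proof.
by move=> c x y; rewrite !tens_mul_def; apply: (tens_lift_linear (mul1_l u) (mul1_r u)).
Qed.

Lemma tens_mul_linear_r t : linear (tens_mul t).
Proof.
apply: (@tensor_linear_param _ _ _ _ _ (fun u => tens_mul^~ u)) => [u|a b c x y].
  exact: tens_mul_linear_l.
by rewrite !tens_mul_tens; apply: (tens_lift_linear (mul_l a b) (mul_r a b)).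
Qed.

Fact tens_mulDl : left_distributive tens_mul +%R.
Proof. by move=> t u v; have := tens_mul_linear_l v 1 t u; rewrite !scale1r. Qed.
Fact tens_mulDr : right_distributive tens_mul +%R.
Proof. by move=> t u v; have := tens_mul_linear_r t 1 u v; rewrite !scale1r. Qed.
Fact tens_mul0l : left_zero 0 tens_mul.
Proof. by move=> t; have [-> _] := linear_fun0Z (tens_mul_linear_l t). Qed.
Fact tens_mul0r : right_zero 0 tens_mul.
Proof. by move=> t; have [-> _] := linear_fun0Z (tens_mul_linear_r t). Qed.
Fact tens_mulZl c t u : tens_mul (c *: t) u = c *: tens_mul t u.
Proof. by have [_ ->] := linear_fun0Z (tens_mul_linear_l u). Qed.
Fact tens_mulZr c t u : tens_mul t (c *: u) = c *: tens_mul t u.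
Proof. by have [_ ->] := linear_fun0Z (tens_mul_linear_r t). Qed.
Fact tens_mulA : associative tens_mul.
Proof.
have comp (X Y Z : lmodType K) (f : Y -> Z) (g : X -> Y) :
  linear f -> linear g -> linear (fun x => f (g x)).
  by move=> lf lg c x y; rewrite lg lf.
have L := tens_mul_linear_l; have R := tens_mul_linear_r.
move=> t u v; move: t.
apply: tensor_linear_ext => [||a b]; [exact: L|exact: comp (L v) (L u)|move: u].
apply: tensor_linear_ext => [||a' b'].
- exact: comp (R _) (L v).
- exact: comp (L v) (R _).
move: v; apply: tensor_linear_ext => [||a'' b'']; [exact: comp (R _) (R _)|exact: R|].
by rewrite !tens_mulE !mulrA.
Qed.
Fact tens_mul1l : left_id (tens 1 1) tens_mul.
Proof.
elim/tensor_ind=> [|c a b t ih]; first by rewrite tens_mul0r.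
by rewrite tens_mulDr ih tens_mulZr tens_mulE !mul1r.
Qed.
Fact tens_mul1r : right_id (tens 1 1) tens_mul.
Proof.
elim/tensor_ind=> [|c a b t ih]; first by rewrite tens_mul0l.
by rewrite tens_mulDl ih tens_mulZl tens_mulE !mulr1.
Qed.

HB.instance Definition _ := GRing.Zmodule_isPzRing.Build (tensor A B)
  tens_mulA tens_mul1l tens_mul1r tens_mulDl tens_mulDr.

Lemma tensM (a a' : A) (b b' : B) : tens a b * tens a' b' = tens (a * a') (b * b').
Proof. exact: tens_mulE. Qed.
Lemma tens1 : tens 1 1 = 1 :> tensor A B. Proof. by []. Qed.
Lemma tensor_scaleAl c (t u : tensor A B) : c *: (t * u) = (c *: t : tensor A B) * u.
Proof. by rewrite -[RHS]/(tens_mul _ _) tens_mulZl. Qed.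
Lemma tensor_scaleAr c (t u : tensor A B) : c *: (t * u) = t * (c *: u : tensor A B).
Proof. by rewrite -[RHS]/(tens_mul _ _) tens_mulZr. Qed.

(* [slice_r phi] is [id (x) phi] and [slice_l phi] is [phi (x) id]. *)

Definition slice_r (phi : {scalar B}) : tensor A B -> A :=
  tens_lift (fun a b => phi b *: a).
Definition slice_l (phi : {scalar A}) : tensor A B -> B :=
  tens_lift (fun a b => phi a *: b).

Lemma slice_r_bil (phi : {scalar B}) : (forall b : B, linear (fun a : A => phi b *: a)) /\
  (forall a : A, linear (fun b : B => phi b *: a)).
Proof.
split=> [b c x y|a c x y]; last by rewrite /= linearD linearZ /= scalerDl scalerA.
by rewrite scalerDr !scalerA mulrC.
Qed.
Lemma slice_l_bil (phi : {scalar A}) : (forall b : B, linear (fun a : A => phi a *: b)) /\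
  (forall a : A, linear (fun b : B => phi a *: b)).
Proof.
split=> [b c x y|a c x y]; first by rewrite /= linearD linearZ /= scalerDl scalerA.
by rewrite scalerDr !scalerA mulrC.
Qed.

Lemma slice_rE phi a b : slice_r phi (tens a b) = phi b *: a.
Proof. by have [? ?] := slice_r_bil phi; apply: tens_liftE. Qed.
Lemma slice_lE phi a b : slice_l phi (tens a b) = phi a *: b.
Proof. by have [? ?] := slice_l_bil phi; apply: tens_liftE. Qed.
Lemma slice_r_linear phi : linear (slice_r phi).
Proof. by have [? ?] := slice_r_bil phi; apply: tens_lift_linear. Qed.
Lemma slice_l_linear phi : linear (slice_l phi).
Proof. by have [? ?] := slice_l_bil phi; apply: tens_lift_linear. Qed.
HB.instance Definition _ phi :=
  GRing.isLinear.Build K (tensor A B) A *:%R (slice_r phi) (slice_r_linear phi).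
HB.instance Definition _ phi :=
  GRing.isLinear.Build K (tensor A B) B *:%R (slice_l phi) (slice_l_linear phi).

End TensorAlgebra.


Lemma malg_scaleAr (K : comNzRingType) (M : monomType) (c : K) (x y : {malg K[M]}) :
  c *: (x * y) = x * (c *: y).
Proof.
apply/malgP => k; rewrite mcoeffZ.
have -> := @mcoeffMlw _ _ (msupp x) (msupp y) x (c *: y) k (fsubset_refl _) (msuppZ_le c y).
have -> := mcoeffMl x y k.
rewrite mulr_sumr; apply: eq_bigr => k1 _.
rewrite mulr_sumr; apply: eq_bigr => k2 _.
by rewrite mcoeffZ mulrnAr mulrCA.
Qed.

Section FreeAlgebra.
Variables (K : comNzRingType) (I : choiceType).

Definition free_alg : Type := {malg K[{fmonom I}]}.
HB.instance Definition _ := GRing.Zmodule.on free_alg.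

(* The operations are locked, lest unification compare distinct products by
   computing them. *)
Fact free_scale_key : unit. Proof. by []. Qed.
Definition free_scale : K -> free_alg -> free_alg :=
  locked_with free_scale_key (fun c x => c *: (x : {malg K[{fmonom I}]})).

Lemma free_scaleE c x : free_scale c x = c *: (x : {malg K[{fmonom I}]}).
Proof. by rewrite /free_scale unlock. Qed.

Fact free_scaleA c d x : free_scale c (free_scale d x) = free_scale (c * d) x.
Proof. by rewrite !free_scaleE; apply: scalerA. Qed.
Fact free_scale1 : left_id 1 free_scale.
Proof. by move=> x; rewrite free_scaleE; apply: scale1r. Qed.
Fact free_scaleDr : right_distributive free_scale +%R.
Proof. by move=> c x y; rewrite !free_scaleE; apply: scalerDr. Qed.
Fact free_scaleDl x : {morph free_scale^~ x : c d / c + d}.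
Proof. by move=> c d; rewrite !free_scaleE; apply: scalerDl. Qed.
HB.instance Definition _ := GRing.Zmodule_isLmodule.Build K free_alg
  free_scaleA free_scale1 free_scaleDr free_scaleDl.

Fact free_mul_key : unit. Proof. by []. Qed.
Definition free_mul : free_alg -> free_alg -> free_alg :=
  locked_with free_mul_key (fun x y => (x : {malg K[{fmonom I}]}) * y).

Lemma free_mulE x y : free_mul x y = (x : {malg K[{fmonom I}]}) * y.
Proof. by rewrite /free_mul unlock. Qed.

Local Notation one := (1 : {malg K[{fmonom I}]}).
Fact free_mulA : associative free_mul.
Proof. by move=> x y z; rewrite !free_mulE; apply: mulrA. Qed.
Fact free_mul1l : left_id one free_mul.
Proof. by move=> x; rewrite free_mulE; apply: mul1r. Qed.
Fact free_mul1r : right_id one free_mul.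
Proof. by move=> x; rewrite free_mulE; apply: mulr1. Qed.
Fact free_mulDl : left_distributive free_mul +%R.
Proof. by move=> x y z; rewrite !free_mulE; apply: mulrDl. Qed.
Fact free_mulDr : right_distributive free_mul +%R.
Proof. by move=> x y z; rewrite !free_mulE; apply: mulrDr. Qed.
Fact free_one_neq0 : one != 0.
Proof. exact: oner_neq0. Qed.
HB.instance Definition _ := GRing.Zmodule_isNzRing.Build free_alg
  free_mulA free_mul1l free_mul1r free_mulDl free_mulDr free_one_neq0.

Fact free_alg_scaleAl (c : K) (x y : free_alg) : c *: (x * y) = (c *: x : free_alg) * y.
Proof.
change (free_scale c (free_mul x y) = free_mul (free_scale c x) y).
by rewrite !free_mulE !free_scaleE; apply: scalerAl.
Qed.
Fact free_alg_scaleAr (c : K) (x y : free_alg) : c *: (x * y) = x * (c *: y : free_alg).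
Proof.
change (free_scale c (free_mul x y) = free_mul x (free_scale c y)).
by rewrite !free_mulE !free_scaleE; apply: malg_scaleAr.
Qed.
HB.instance Definition _ :=
  GRing.Lmodule_isLalgebra.Build K free_alg free_alg_scaleAl.
HB.instance Definition _ :=
  GRing.Lalgebra_isAlgebra.Build K free_alg free_alg_scaleAr.

End FreeAlgebra.

HB.lock Definition fvar (K : comNzRingType) (I : choiceType) (i : I) :
  free_alg K I := << fmu i >>.
Arguments fvar {K I} i.

Section Character.
Variables (K : comNzRingType) (I : choiceType).
Local Notation free_alg := (free_alg K I).
Variable e : I -> K.

Definition monom_eval (m : {fmonom I}) : K := \prod_(i <- m) e i.

Fact monom_eval_mmorphism : mmorphism monom_eval.
Proof.
split=> [x y|]; rewrite /monom_eval; first by rewrite fmM big_cat.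
by rewrite fm1 big_nil.
Qed.
HB.instance Definition _ :=
  isMultiplicative.Build {fmonom I} K monom_eval monom_eval_mmorphism.

Fact free_character_key : unit. Proof. by []. Qed.
Definition free_character : free_alg -> K :=
  locked_with free_character_key (mmap idfun monom_eval).

Fact free_character_additive : {morph free_character : x y / x - y}.
Proof. by rewrite /free_character unlock; apply: raddfB. Qed.
Fact free_character_monoid : monoid_morphism free_character.
Proof.
rewrite /free_character unlock.
split=> [|x y]; first exact: rmorph1.
by change (mmap idfun monom_eval (free_mul x y) =
  mmap idfun monom_eval x * mmap idfun monom_eval y); rewrite free_mulE; apply: rmorphM.
Qed.
HB.instance Definition _ :=
  GRing.isZmodMorphism.Build free_alg K free_character free_character_additive.
HB.instance Definition _ :=
  GRing.isMonoidMorphism.Build free_alg K free_character free_character_monoid.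

Lemma free_characterZ c x : free_character (c *: x) = c * free_character x.
Proof.
rewrite -[c *: x]/(free_scale c x) free_scaleE /free_character unlock.
exact: mmap_is_linear.
Qed.

Lemma free_character_var i : free_character (fvar i) = e i.
Proof.
by rewrite /free_character unlock fvar.unlock mmapU mul1r /= /monom_eval fmU big_seq1.
Qed.
End Character.

(* [xi r I J] is the quantum minor with rows [I 0 < ... < I (r-1)] and columns
   [J 0 < ... < J (r-1)]; the index sets are given by their increasing
   enumerations. The product over [s < r] is taken in increasing order of [s]. *)
Definition inversions (r : nat) (tau : 'S_r) : nat :=
  #|[set p : 'I_r * 'I_r | (p.1 < p.2)%N && (tau p.2 < tau p.1)%N]|.

Definition xi (K : comNzRingType) (A : algType K) (q : K) (x : 'I_3 -> 'I_3 -> A)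
    (r : nat) (I J : 'I_r -> 'I_3) : A :=
  \sum_(tau : 'S_r) (- q) ^+ inversions tau *: \prod_(s < r) x (I s) (J (tau s)).

Definition qdet (K : comNzRingType) (A : algType K) (q : K) (x : 'I_3 -> 'I_3 -> A) : A :=
  xi q x (id : 'I_3 -> 'I_3) id.

Section GLq.
Variables (R : realType) (q : R).
Local Notation C := R[i].
Local Open Scope complex_scope.

(* [Some (i, j)] stands for x_{i,j} and [None] for det_q^{-1}; indices start at 0. *)
Local Notation free := (free_alg C (option ('I_3 * 'I_3)%type)).
Local Notation X i j := (fvar (Some (i, j)) : free).
Local Notation T := (fvar None : free).

(* The defining relations are [r = 0] for [GLq_rel r]. *)
Inductive GLq_rel : free -> Prop :=
| GLq_col (i l j : 'I_3) : (i < l)%N ->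
    GLq_rel (X i j * X l j - q%:C *: (X l j * X i j))
| GLq_row (i j k : 'I_3) : (j < k)%N ->
    GLq_rel (X i j * X i k - q%:C *: (X i k * X i j))
| GLq_antidiag (i l j k : 'I_3) : (i < l)%N -> (j < k)%N ->
    GLq_rel (X i k * X l j - X l j * X i k)
| GLq_diag (i l j k : 'I_3) : (i < l)%N -> (j < k)%N ->
    GLq_rel (X i j * X l k - (X l k * X i j + (q - q^-1)%:C *: (X i k * X l j)))
| GLq_central (i j : 'I_3) : GLq_rel (T * X i j - X i j * T)
| GLq_detinv : GLq_rel (qdet q%:C (fun i j => X i j) * T - 1).

Definition OGLq : Type := qalg GLq_rel.
HB.instance Definition _ := GRing.Lmodule.on OGLq.
HB.instance Definition _ := GRing.PzRing.on OGLq.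

Definition GLq_pi : free -> OGLq := @qalg_pi C free GLq_rel.
HB.instance Definition _ := GRing.Linear.on GLq_pi.
HB.instance Definition _ := GRing.RMorphism.on GLq_pi.

Let eps0 : option ('I_3 * 'I_3) -> C := fun g =>
  if g is Some (i, j) then (i == j)%:R else 1.

Lemma inversions1 r : inversions (1%g : 'S_r) = 0%N.
Proof.
apply: eq_card0 => -[i j]; rewrite !inE !perm1 /=.
by case: ltngtP.
Qed.

Lemma GLq_rel_eps s : GLq_rel s -> free_character eps0 s = 0.
Proof.
have E i j : free_character eps0 (X i j) = (i == j)%:R by exact: free_character_var.
have E' : free_character eps0 T = 1 by exact: free_character_var.
case=> [i l j il|i j k jk|i l j k il jk|i l j k il jk|i j|].
- rewrite rmorphB rmorphM /= free_characterZ rmorphM /= !E.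
  have [eij|_] := eqVneq i j; last by rewrite !(mul0r, mulr0) subrr.
  by rewrite -eij [l == i]gtn_eqF // !(mul0r, mulr0) subrr.
- rewrite rmorphB rmorphM /= free_characterZ rmorphM /= !E.
  have [eij|_] := eqVneq i j; last by rewrite !(mul0r, mulr0) subrr.
  by rewrite eij [j == k]ltn_eqF // !(mul0r, mulr0) subrr.
- by rewrite rmorphB rmorphM /= !E rmorphM /= !E [(i == k)%:R * _]mulrC subrr.
- rewrite rmorphB rmorphM /= !E rmorphD /= rmorphM /= !E free_characterZ rmorphM /= !E opprD addrA.
  rewrite (mulrC ((l == k)%:R)) subrr sub0r.
  have [eik|_] := eqVneq i k; last by rewrite mul0r mulr0 oppr0.
  have [elj|_] := eqVneq l j; last by rewrite !mulr0 oppr0.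
  by move: jk; rewrite -elj -eik ltnNge (ltnW il).
- by rewrite rmorphB rmorphM /= E E' rmorphM /= E E' mul1r mulr1 subrr.
rewrite rmorphB rmorphM rmorph1 /= E' mulr1 /qdet /xi rmorph_sum /= (bigD1 (1%g : 'S_3)) //=.
rewrite [Y in _ + Y - _]big1 => [|tau /eqP tau1].
  rewrite addr0 free_characterZ rmorph_prod inversions1 expr0 mul1r /=.
  by rewrite big1 ?subrr // => i _; rewrite E perm1 eqxx.
have [i ti] : exists i, tau i != i.
  apply/existsP; rewrite -negb_forall; apply: contra_notN tau1 => /forallP t1.
  by apply/permP => i; rewrite perm1; apply/eqP/t1.
rewrite free_characterZ rmorph_prod /= (bigD1 i) //= E.
by rewrite eq_sym (negPf ti) mul0r mulr0.
Qed.

Fact OGLq_one_neq0 : 1 != 0 :> OGLq.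
Proof.
apply/eqP => /= e.
have : span (ideal_mem GLq_rel) (1 - 0 : free).
  by apply/qpiP; rewrite linear0; exact: e.
rewrite subr0 => sp; have : free_character eps0 1 = 0.
  elim: sp => [|c _ x [u [r [v [rr ->]]]] _ ih]; first exact: rmorph0.
  rewrite rmorphD /= free_characterZ ih addr0 !rmorphM /= (GLq_rel_eps rr).
  by rewrite mulr0 mul0r mulr0.
by rewrite rmorph1 => /eqP; rewrite oner_eq0.
Qed.
HB.instance Definition _ := GRing.PzSemiRing_isNonZero.Build OGLq OGLq_one_neq0.
HB.instance Definition _ := GRing.Lmodule_isLalgebra.Build C OGLq (@qalg_scaleAl C free GLq_rel).
HB.instance Definition _ := GRing.Lalgebra_isAlgebra.Build C OGLq (@qalg_scaleAr C free GLq_rel).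

Definition gen (i j : 'I_3) : OGLq := GLq_pi (X i j).
Definition detinv : OGLq := GLq_pi T.

(* [lift i : 'I_2 -> 'I_3] enumerates the complement of [i] increasingly. *)
Definition cominor (i j : 'I_3) : OGLq := xi q%:C gen (lift i) (lift j).

Fact GLq_pi_rel (x y : free) : GLq_rel (x - y) -> GLq_pi x = GLq_pi y.
Proof.
move=> r; apply/eqP; rewrite -subr_eq0 -linearB; apply/eqP.
exact: (qalg_rel r).
Qed.

Lemma gen_col (i l j : 'I_3) : (i < l)%N ->
  gen i j * gen l j = q%:C *: (gen l j * gen i j).
Proof.
by move=> il; have := GLq_pi_rel (GLq_col j il); rewrite linearZ /= !rmorphM.
Qed.

Lemma gen_row (i j k : 'I_3) : (j < k)%N ->
  gen i j * gen i k = q%:C *: (gen i k * gen i j).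
Proof.
by move=> jk; have := GLq_pi_rel (GLq_row i jk); rewrite linearZ /= !rmorphM.
Qed.

Lemma gen_antidiag (i l j k : 'I_3) : (i < l)%N -> (j < k)%N ->
  gen i k * gen l j = gen l j * gen i k.
Proof.
by move=> il jk; have := GLq_pi_rel (GLq_antidiag il jk); rewrite !rmorphM.
Qed.

Lemma gen_diag (i l j k : 'I_3) : (i < l)%N -> (j < k)%N ->
  gen i j * gen l k =
  gen l k * gen i j + (q - q^-1)%:C *: (gen i k * gen l j).
Proof.
move=> il jk; have := GLq_pi_rel (GLq_diag il jk).
by rewrite linearD linearZ /= !rmorphM.
Qed.

Lemma detinv_central (i j : 'I_3) : detinv * gen i j = gen i j * detinv.
Proof. by have := GLq_pi_rel (GLq_central i j); rewrite !rmorphM. Qed.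

Lemma qdet_detinv : qdet q%:C gen * detinv = 1.
Proof.
have := GLq_pi_rel GLq_detinv; rewrite rmorphM rmorph1 => <-; congr (_ * _).
rewrite /qdet /xi rmorph_sum; apply: eq_bigr => tau _ /=.
by rewrite linearZ /= rmorph_prod.
Qed.

Record is_comul (Delta : {lrmorphism OGLq -> tensor OGLq OGLq}) : Prop := {
  comul_gen : forall i j, Delta (gen i j) = \sum_(p < 3) tens (gen i p) (gen p j);
  comul_detinv : Delta detinv = tens detinv detinv
}.

Record is_star (star : OGLq -> OGLq) : Prop := {
  starD : forall x y, star (x + y) = star x + star y;
  starZ : forall (c : C) x, star (c *: x) = c^* *: star x;
  starM : forall x y, star (x * y) = star y * star x;
  starK : involutive star;
  star_gen : forall i j, star (gen i j) =
    ((- q) ^ ((j : nat)%:Z - (i : nat)%:Z))%:C *: (cominor i j * detinv);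
  star_qdet : star (qdet q%:C gen) = detinv
}.

Record is_haar_state (Delta : {lrmorphism OGLq -> tensor OGLq OGLq})
    (haar : {scalar OGLq}) : Prop := {
  haar1 : haar 1 = 1;
  haar_right : forall x, slice_r haar (Delta x) = haar x *: 1;
  haar_left : forall x, slice_l haar (Delta x) = haar x *: 1
}.

End GLq.

Arguments gen {R q} i j.
Arguments detinv {R q}.

Definition qpoch (R : fieldType) (x p : R) (N : nat) : R :=
  \prod_(i < N) (1 - x * p ^+ i).

Definition qbinom (R : fieldType) (p : R) (N j : nat) : R :=
  if (j <= N)%N then qpoch p p N / (qpoch p p j * qpoch p p (N - j)) else 0.

(* Main.v *)
From HB Require Import structures.
Require Import Defs.
From mathcomp Require Import all_boot all_order all_algebra perm.
From mathcomp Require Import monalg reals complex.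
From mathcomp Require Import ring zify.

Set Implicit Arguments.
Unset Strict Implicit.
Unset Printing Implicit Defensive.

Import Order.TTheory GRing.Theory Num.Theory.
Local Open Scope ring_scope.

(* Let x and v be the first and third rows of the generators, and y = x^*,
   u = v^*. The words u_2^a u_1^b x_0^g x_1^d x_2^e lie in one irreducible
   comodule for the column coaction, and the Haar values in question are entries
   of its invariant Gram matrix.

   The Chevalley generators acting on columns are twisted derivations T with
   h o T = 0; they come from algebra maps of O(GL_q(3)) to 2x2 upper triangular
   matrices. Applying h o T to a product of two words, and eliminating u_0 and
   v_0 through sum_j q^(2(2-j)) u_j x_j = 0 and its adjoint, gives recursions
   between Gram entries; the relations sum_j x_j y_j = 1 and
   sum_j q^(2(2-j)) u_j v_j = 1 fix the normalisation. The entries against words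
   without x_1 turn out to be products of q-factorials, which the q-Saalschuetz
   sum identifies with the formula for k = c_2; the general case follows by
   induction on c_2 - k. *)

(** * Algebra maps out of O(GL_q(3)) *)

(** The case [k = c_2] is special because the left word then contains no [x_1], the only letter of a
    left word that [E1] moves. So [E1] kills it, and the resulting relation keeps the left word
    fixed and has only two terms. At the same time the inner sum of the formula shrinks to [i = 0].
    For [k < c_2] the three-term relation of [F1] takes over; on the side of the formula it is
    matched, for each [j] separately, by a contiguity relation of the inner sum.

    The anchor of all recursions is the squared norm of the highest weight vector u_2^m x_0^n.
    Inserting one of the two unit relations between the two words produces unwanted summands, which
    [F1], [F2] and [E1] turn back into such norms.

    No recursion is ever solved: Gram entries and closed formulas are shown to obey the same ones.
    The leading coefficients are, up to powers of q, products of factors 1 - q^(2n) with n > 0,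
    nonzero because q is real and not 0, 1 or -1. *)

Lemma eq_subr0 (V : zmodType) (x y : V) : x = y -> x - y = 0.
Proof. by move->; rewrite subrr. Qed.

Lemma subr0_inj (V : zmodType) (x y : V) : x - y = 0 -> x = y.
Proof. by move/eqP; rewrite subr_eq0 => /eqP. Qed.

(** Certificates of linear dependence: a goal [X - Y = 0] is displayed as an explicit combination of
    known zeros, and the remaining identity is left to [field] or [ring]. *)
Lemma lincomb2_eq0 (R : pzRingType) (c1 c2 a1 a2 : R) :
  a1 = 0 -> a2 = 0 -> c1 * a1 + c2 * a2 = 0.
Proof. by move=> -> ->; rewrite !mulr0 addr0. Qed.

Lemma lincomb3_eq0 (R : pzRingType) (c1 c2 c3 a1 a2 a3 : R) :
  a1 = 0 -> a2 = 0 -> a3 = 0 -> c1 * a1 + c2 * a2 + c3 * a3 = 0.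
Proof. by move=> -> -> ->; rewrite !mulr0 !addr0. Qed.

Section FreeEval.
Variables (K : comNzRingType) (I : choiceType) (S : algType K) (e : I -> S).

Definition word_eval (m : {fmonom I}) : S := \prod_(i <- m) e i.

Fact word_eval_mmorphism : mmorphism word_eval.
Proof.
split=> [x y|]; rewrite /word_eval; first by rewrite fmM big_cat.
by rewrite fm1 big_nil.
Qed.
HB.instance Definition _ :=
  isMultiplicative.Build {fmonom I} S word_eval word_eval_mmorphism.

(** The analogue of [free_character] for a noncommutative target, here a matrix algebra.
    Multiplicativity only needs the images of the scalars to be central. *)
Definition free_eval (x : free_alg K I) : S :=
  mmap (in_alg S) word_eval (x : {malg K[{fmonom I}]}).

Fact free_eval_additive : {morph free_eval : x y / x - y}.
Proof. by move=> x y; apply: raddfB. Qed.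
HB.instance Definition _ :=
  GRing.isZmodMorphism.Build (free_alg K I) S free_eval free_eval_additive.

Fact free_eval_monoid : monoid_morphism free_eval.
Proof.
split=> [|x y]; first exact: mmap1.
change (mmap (in_alg S) word_eval (free_mul x y) =
  mmap (in_alg S) word_eval x * mmap (in_alg S) word_eval y).
rewrite free_mulE.
have [-> //] : multiplicative (mmap (in_alg S) word_eval).
apply: commr_mmap_is_multiplicative => g m m'.
by rewrite /GRing.comm /= mulr_algl mulr_algr.
Qed.

HB.instance Definition _ :=
  GRing.isMonoidMorphism.Build (free_alg K I) S free_eval free_eval_monoid.

Fact free_eval_scalable : scalable free_eval.
Proof.
move=> c x; rewrite -[c *: x]/(free_scale c x) free_scaleE /free_eval mmapZ.
by rewrite /= mulr_algl.
Qed.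

HB.instance Definition _ :=
  GRing.isScalable.Build K (free_alg K I) S *:%R free_eval free_eval_scalable.

Lemma free_evalZ c x : free_eval (c *: x) = c *: free_eval x.
Proof. exact: linearZ. Qed.

Lemma free_eval_var i : free_eval (fvar i) = e i.
Proof.
by rewrite /free_eval fvar.unlock mmapU /= scale1r mul1r /word_eval fmU big_seq1.
Qed.

End FreeEval.

Section GLqEval.
Variables (R : realType) (q : R) (S : algType R[i]).
Variable e : option ('I_3 * 'I_3) -> S.
Hypothesis e_rel : forall r, GLq_rel q r -> free_eval e r = 0.

Definition GLq_eval (t : OGLq q) : S := qlift (free_eval e) t.

Lemma ideal_mem_eval0 r : ideal_mem (GLq_rel q) r -> free_eval e r = 0.
Proof. by move=> [a [b [c [rb ->]]]]; rewrite !rmorphM /= (e_rel rb) mulr0 mul0r. Qed.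

Lemma GLq_eval_pi x : GLq_eval (GLq_pi q x) = free_eval e x.
Proof. exact: (qliftE ideal_mem_eval0). Qed.

Lemma GLq_eval_linear : linear GLq_eval.
Proof. exact: (qlift_linear ideal_mem_eval0). Qed.

Lemma GLq_eval1 : GLq_eval 1 = 1.
Proof. by rewrite -(rmorph1 (GLq_pi q)) GLq_eval_pi rmorph1. Qed.

Lemma GLq_evalM : {morph GLq_eval : x y / x * y}.
Proof.
move=> t u; have [x ->] := qalg_piK t; have [y ->] := qalg_piK u.
by rewrite -rmorphM !GLq_eval_pi rmorphM.
Qed.

Lemma GLq_eval_gen i j : GLq_eval (gen i j) = e (Some (i, j)).
Proof. by rewrite GLq_eval_pi free_eval_var. Qed.

Lemma GLq_eval_detinv : GLq_eval detinv = e None.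
Proof. by rewrite GLq_eval_pi free_eval_var. Qed.

End GLqEval.

(** * Explicit quantum minors of size two and three *)

Section SmallMinors.

Local Notation i0 := (0 : 'I_3).
Local Notation i1 := (1 : 'I_3).
Local Notation i2 := (2 : 'I_3).

Lemma inversions_sum r (tau : 'S_r) : inversions tau =
  (\sum_(i < r) \sum_(j < r) ((i < j) && (tau j < tau i)))%N.
Proof.
rewrite /inversions -sum1_card pair_big /= big_mkcond /=.
by apply: eq_bigr => p _; rewrite inE; case: ifP.
Qed.

Lemma tperm_if (T : finType) (x y z : T) :
  tperm x y z = if z == x then y else if z == y then x else z.
Proof. by case: tpermP => [->|->|/eqP/negPf-> /eqP/negPf->] //; rewrite eqxx //; case: eqP. Qed.

Lemma sum_S2 (V : nmodType) (F : 'S_2 -> V) :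
  \sum_tau F tau = F 1%g + F (tperm 0 1).
Proof.
pose s : seq {perm 'I_2} := [:: 1%g; tperm 0 1].
have us : uniq s.
  apply: (@map_uniq _ _ (fun t : 'S_2 => val (t 0))).
  by rewrite /= !perm1 !tperm_if.
have E : perm_eq (index_enum {perm 'I_2}) s.
  rewrite perm_sym; apply: (uniq_perm us (index_enum_uniq _)).
  have sub : {subset s <= index_enum {perm 'I_2}} by move=> t _; rewrite mem_index_enum.
  have [] // := uniq_min_size us sub.
  rewrite (_ : size (index_enum _) = #|{perm 'I_2}|); last by rewrite cardE enumT.
  by rewrite card_Sn.
by rewrite (perm_big _ E) /= !big_cons big_nil addr0.
Qed.

Lemma sum_S3 (V : nmodType) (F : 'S_3 -> V) :
  \sum_tau F tau = F 1%g + F (tperm i0 i1) + F (tperm i1 i2) + F (tperm i0 i2)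
    + F (tperm i0 i1 * tperm i1 i2)%g + F (tperm i1 i2 * tperm i0 i1)%g.
Proof.
pose s : seq {perm 'I_3} := [:: 1%g; tperm i0 i1; tperm i1 i2; tperm i0 i2;
  (tperm i0 i1 * tperm i1 i2)%g; (tperm i1 i2 * tperm i0 i1)%g].
(* The images of 0 and 1 separate the six permutations; since 3! = 6, the list is exhaustive. *)
have us : uniq s.
  apply: (@map_uniq _ _ (fun t : 'S_3 => (val (t i0), val (t i1)))).
  by rewrite /= !permM !perm1 !tperm_if.
have E : perm_eq (index_enum {perm 'I_3}) s.
  rewrite perm_sym; apply: (uniq_perm us (index_enum_uniq _)).
  have sub : {subset s <= index_enum {perm 'I_3}} by move=> t _; rewrite mem_index_enum.
  have [] // := uniq_min_size us sub.
  rewrite (_ : size (index_enum _) = #|{perm 'I_3}|); last by rewrite cardE enumT.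
  by rewrite card_Sn.
by rewrite (perm_big _ E) /= !big_cons big_nil addr0 !addrA.
Qed.

Lemma inversions_S3 :
  [/\ inversions (tperm i0 i1) = 1, inversions (tperm i1 i2) = 1,
      inversions (tperm i0 i2) = 3, inversions (tperm i0 i1 * tperm i1 i2)%g = 2
    & inversions (tperm i1 i2 * tperm i0 i1)%g = 2]%N.
Proof.
by split; rewrite inversions_sum !big_ord_recl !big_ord0 /= !(permM, tperm_if).
Qed.

Lemma inversions_S2 : inversions (tperm (0 : 'I_2) 1) = 1%N.
Proof. by rewrite inversions_sum !big_ord_recl !big_ord0 /= !tperm_if. Qed.

Variables (K : comNzRingType) (A : algType K) (q : K) (x : 'I_3 -> 'I_3 -> A).

Lemma xi2E (I J : 'I_2 -> 'I_3) : xi q x I J =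
  x (I 0) (J 0) * x (I 1) (J 1) - q *: (x (I 0) (J 1) * x (I 1) (J 0)).
Proof.
have e1 : lift ord0 ord0 = 1 :> 'I_2 by apply/val_inj.
rewrite /xi sum_S2 inversions1 inversions_S2 expr0 scale1r expr1 scaleNr.
by rewrite !big_ord_recl !big_ord0 !mulr1 !perm1 e1 tpermL tpermR.
Qed.

Lemma qdet3E : qdet q x =
  x i0 i0 * x i1 i1 * x i2 i2 - q *: (x i0 i1 * x i1 i0 * x i2 i2)
  - q *: (x i0 i0 * x i1 i2 * x i2 i1) - q ^+ 3 *: (x i0 i2 * x i1 i1 * x i2 i0)
  + q ^+ 2 *: (x i0 i2 * x i1 i0 * x i2 i1) + q ^+ 2 *: (x i0 i1 * x i1 i2 * x i2 i0).
Proof.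
have [e01 e12 e02 e012 e120] := inversions_S3.
have e1 : lift ord0 ord0 = i1 by apply/val_inj.
have e2 : lift ord0 (lift ord0 ord0) = i2 by apply/val_inj.
have t120 : tperm i1 i2 i0 = i0 by rewrite tpermD.
have t021 : tperm i0 i2 i1 = i1 by rewrite tpermD.
have prod3 (t : 'S_3) : \prod_(s < 3) x s (t s) = x i0 (t i0) * x i1 (t i1) * x i2 (t i2).
  by rewrite !big_ord_recl big_ord0 mulr1 mulrA e2 e1.
rewrite /qdet /xi sum_S3 inversions1 e01 e12 e02 e012 e120 !prod3.
have t012 : tperm i0 i1 i2 = i2 by rewrite tpermD.
rewrite !permM !perm1 !(tpermL, tpermR, t120, t021, t012) expr0 scale1r.
have -> : (- q) ^+ 3 = - q ^+ 3 by rewrite exprNn -signr_odd expr1 mulN1r.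
by rewrite expr1 sqrrN !scaleNr.
Qed.

End SmallMinors.

Section UpperTriangular.
Variable K : nzRingType.

(** An algebra map into such matrices packages two characters [a], [c] and a functional [b] with
    b(xy) = a(x) b(y) + b(x) c(y), so checking the defining relations once yields all three. *)
Definition ut (a b c : K) : 'M[K]_2 :=
  \matrix_(i, j) if i == 0 then (if j == 0 then a else b)
                 else (if j == 0 then 0 else c).

Lemma utM a b c a' b' c' :
  ut a b c * ut a' b' c' = ut (a * a') (a * b' + b * c') (c * c').
Proof.
apply/matrixP => i j; rewrite !mxE !big_ord_recl big_ord0 !mxE /= addr0.
by case: i j => [[|[|i]] // ?] [[|[|j]] // ?] /=; rewrite ?mulr0 ?mul0r ?addr0 ?add0r.
Qed.

Lemma utD a b c a' b' c' :
  ut a b c + ut a' b' c' = ut (a + a') (b + b') (c + c').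
Proof.
apply/matrixP => i j; rewrite !mxE.
by case: i j => [[|[|i]] // ?] [[|[|j]] // ?] /=; rewrite ?addr0.
Qed.

Lemma utN a b c : - ut a b c = ut (- a) (- b) (- c).
Proof.
apply/matrixP => i j; rewrite !mxE.
by case: i j => [[|[|i]] // ?] [[|[|j]] // ?] /=; rewrite ?oppr0.
Qed.

Lemma utZ k a b c : k *: ut a b c = ut (k * a) (k * b) (k * c).
Proof.
apply/matrixP => i j; rewrite !mxE.
by case: i j => [[|[|i]] // ?] [[|[|j]] // ?] /=; rewrite ?mulr0.
Qed.

Lemma ut1 : 1 = ut 1 0 1.
Proof.
apply/matrixP => i j; rewrite !mxE.
by case: i j => [[|[|i]] // ?] [[|[|j]] // ?].
Qed.

Lemma ut0 : 0 = ut 0 0 0.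
Proof.
apply/matrixP => i j; rewrite !mxE.
by case: i j => [[|[|i]] // ?] [[|[|j]] // ?].
Qed.

End UpperTriangular.

Section RootRepresentation.
Variables (R : realType) (q : R).
Hypothesis q_neq0 : q != 0.
Local Notation C := R[i].
Local Notation Q := (q%:C)%C.

(** Simple roots only: for columns two apart the diagonal relations fail. For instance x_{0,1}
    x_{1,2} involves x_{0,2} x_{1,1}, where [T] would not vanish. *)
Definition adjacent (a b : 'I_3) : bool := (a.+1 == b) || (b.+1 == a).

(** Symmetric in [a] and [b]: the raising and the lowering operator of a root share the same
    twist. *)
Definition root_weight (a b i : 'I_3) : C :=
  if i == minn a b :> nat then Q^-1 else if i == maxn a b :> nat then Q else 1.

(* [x |-> [[eps x, T x], [0, K x]]], where [T] is the skew-primitive functional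
   dual to [x_{a,b}]. Acting with [T] replaces column [b] by column [a]. *)
Definition root_mx (a b : 'I_3) (g : option ('I_3 * 'I_3)) : 'M[C]_2 :=
  if g is Some (i, j) then
    ut (i == j)%:R ((i == a) && (j == b))%:R ((i == j)%:R * root_weight a b i)
  else 1.

Lemma QV_sub : ((q - q^-1)%:C)%C = Q - Q^-1.
Proof. by rewrite rmorphB fmorphV. Qed.

Lemma free_eval_qdet (S : algType C) (e : option ('I_3 * 'I_3) -> S) :
  free_eval e (qdet Q (fun i j => fvar (Some (i, j)))) = qdet Q (fun i j => e (Some (i, j))).
Proof.
rewrite /qdet /xi rmorph_sum; apply: eq_bigr => tau _ /=.
by rewrite free_evalZ rmorph_prod; congr (_ *: _); apply: eq_bigr => i _; apply: free_eval_var.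
Qed.

Lemma root_mx_rel (a b : 'I_3) : adjacent a b ->
  forall r, GLq_rel q r -> free_eval (root_mx a b) r = 0.
Proof.
have Q0 : Q != 0 by rewrite fmorph_eq0.
rewrite /adjacent => ab_adj r.
have E i j : free_eval (root_mx a b) (fvar (Some (i, j))) =
    root_mx a b (Some (i, j)) by exact: free_eval_var.
have ET : free_eval (root_mx a b) (fvar None) = 1 by exact: free_eval_var.
case=> [i l j il|i j k jk|i l j k il jk|i l j k il jk|i j|].
- rewrite rmorphB /= free_evalZ !rmorphM /= !E /= !utM utZ utN utD ut0.
  case: a b ab_adj {E ET} => [[|[|[|?]]] ?] [[|[|[|?]]] ?] //= _;
  case: i l il j => [[|[|[|?]]] ?] [[|[|[|?]]] ?] //= _ [[|[|[|?]]] ?] //=;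
  by rewrite /root_weight /=; congr ut; field; rewrite ?fmorph_eq0.
- rewrite rmorphB /= free_evalZ !rmorphM /= !E /= !utM utZ utN utD ut0.
  case: a b ab_adj {E ET} => [[|[|[|?]]] ?] [[|[|[|?]]] ?] //= _;
  case: j k jk i => [[|[|[|?]]] ?] [[|[|[|?]]] ?] //= _ [[|[|[|?]]] ?] //=;
  by rewrite /root_weight /=; congr ut; field; rewrite ?fmorph_eq0.
- rewrite rmorphB /= !rmorphM /= !E /= !utM utN utD ut0.
  case: a b ab_adj {E ET} => [[|[|[|?]]] ?] [[|[|[|?]]] ?] //= _;
  case: i l il j k jk => [[|[|[|?]]] ?] [[|[|[|?]]] ?] //= _;
  case=> [[|[|[|?]]] ?] [[|[|[|?]]] ?] //= _;
  by rewrite /root_weight /=; congr ut; field; rewrite ?fmorph_eq0.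
- rewrite rmorphB rmorphD /= free_evalZ !rmorphM /= !E /= !utM utZ utD utN utD ut0 QV_sub.
  case: a b ab_adj {E ET} => [[|[|[|?]]] ?] [[|[|[|?]]] ?] //= _;
  case: i l il j k jk => [[|[|[|?]]] ?] [[|[|[|?]]] ?] //= _;
  case=> [[|[|[|?]]] ?] [[|[|[|?]]] ?] //= _;
  by rewrite /root_weight /=; congr ut; field; rewrite ?fmorph_eq0.
- by rewrite rmorphB /= !rmorphM /= ET mul1r mulr1 subrr.
rewrite rmorphB rmorphM /= rmorph1 ET mulr1 free_eval_qdet qdet3E.
rewrite /root_mx !utM !utZ !(utN, utD) ut1 utN utD ut0.
case: a b ab_adj {E ET} => [[|[|[|?]]] ?] [[|[|[|?]]] ?] //= _;
by rewrite /root_weight /=; congr ut; field; rewrite ?fmorph_eq0.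
Qed.

End RootRepresentation.

(** * Twisted derivations from the column coaction *)

Lemma slice_lr (K : comNzRingType) (A B : algType K)
    (phi : {scalar A}) (psi : {scalar B}) (t : tensor A B) :
  phi (slice_r psi t) = psi (slice_l phi t).
Proof.
apply: (@tensor_linear_ext _ _ _ K^o (fun t => phi (slice_r psi t))
  (fun t => psi (slice_l phi t))) => [c x y|c x y|x y].
- by rewrite !linearP.
- by rewrite !linearP.
- by rewrite slice_rE slice_lE !linearZ /= mulrC.
Qed.

Section Coaction.
Variables (R : realType) (q : R).
Hypothesis q_neq0 : q != 0.
Local Notation C := R[i].
Local Notation Q := (q%:C)%C.
Local Notation A := (OGLq q).
Variable Delta : {lrmorphism A -> tensor A A}.
Hypothesis HDelta : is_comul Delta.
Variable haar : {scalar A}.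
Hypothesis Hhaar : is_haar_state Delta haar.
Variables a b : 'I_3.
Hypothesis ab_adj : adjacent a b.

Local Notation rho := (@GLq_eval R q _ (root_mx q a b)).
Let rel0 := root_mx_rel q_neq0 ab_adj.

Definition root_coord (i j : 'I_2) (x : A) : C := rho x i j.

Fact root_coord_linear i j : linear_for *%R (root_coord i j).
Proof. by move=> c x y; rewrite /root_coord (GLq_eval_linear rel0) !mxE. Qed.
HB.instance Definition _ i j :=
  GRing.isLinear.Build C A C *%R (root_coord i j) (root_coord_linear i j).

Lemma root_coordM i j x y :
  root_coord i j (x * y) = \sum_k root_coord i k x * root_coord k j y.
Proof. by rewrite /root_coord (GLq_evalM rel0) mxE. Qed.

Lemma slice_root_coordM i j (s t : tensor A A) : slice_r (root_coord i j) (s * t) =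
  \sum_k slice_r (root_coord i k) s * slice_r (root_coord k j) t.
Proof.
move: s; apply: tensor_linear_ext => [c x y|c x y|x y].
- by rewrite mulrDl -tensor_scaleAl linearP.
- rewrite scaler_sumr -big_split /=; apply: eq_bigr => k _.
  by rewrite linearP mulrDl -scalerAl.
move: t; apply: tensor_linear_ext => [c z t|c z t|z t].
- by rewrite mulrDr -tensor_scaleAr linearP.
- rewrite scaler_sumr -big_split /=; apply: eq_bigr => k _.
  by rewrite linearP mulrDr -scalerAr.
rewrite tensM slice_rE /= root_coordM scaler_suml; apply: eq_bigr => k _.
by rewrite !slice_rE -scalerAl -scalerAr scalerA.
Qed.

Definition coact (x : A) : 'M[A]_2 :=
  \matrix_(i, j) slice_r (root_coord i j) (Delta x).

Lemma coactM x y : coact (x * y) = coact x * coact y.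
Proof.
apply/matrixP => i j; rewrite !mxE rmorphM slice_root_coordM.
by apply: eq_bigr => k _; rewrite !mxE.
Qed.

Lemma coactB x y : coact (x - y) = coact x - coact y.
Proof. by apply/matrixP => i j; rewrite !mxE !linearB. Qed.

(** The upper left entry says that the counit property holds at [x]. It is known on generators and
    propagates through products together with the values [y] of the derivation and [z] of the
    twist. *)
Definition act x y z := coact x = ut x y z.

Lemma act_mul x y z x' y' z' : act x y z -> act x' y' z' ->
  act (x * x') (x * y' + y * z') (z * z').
Proof. by rewrite /act coactM => -> ->; rewrite utM. Qed.

Lemma act_sub x y z x' y' z' : act x y z -> act x' y' z' ->
  act (x - x') (y - y') (z - z').
Proof. by rewrite /act coactB => -> ->; rewrite utN utD. Qed.

Lemma act_scale c x y z : act x y z -> act (c *: x) (c *: y) (c *: z).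
Proof.
move=> xyz; apply/matrixP => i j; move/matrixP/(_ i j): xyz; rewrite !mxE !linearZ /= => ->.
by case: i j => [[|[|i]] // ?] [[|[|j]] // ?] /=; rewrite ?scaler0.
Qed.

Lemma root_coord1 i j : root_coord i j 1 = (i == j)%:R.
Proof. by rewrite /root_coord (GLq_eval1 rel0) mxE. Qed.

Lemma act1 : act 1 0 1.
Proof.
apply/matrixP => i j; rewrite !mxE rmorph1 -tens1 slice_rE /= root_coord1.
by case: i j => [[|[|i]] // ?] [[|[|j]] // ?] /=; rewrite ?scale1r ?scale0r.
Qed.

Lemma act_gen i j : act (gen i j) (if j == b then gen i a else 0)
  (root_weight q a b j *: gen i j).
Proof.
apply/matrixP => k l; rewrite !mxE (comul_gen HDelta) linear_sum /=.
under eq_bigr => p _ do rewrite slice_rE /= /root_coord (GLq_eval_gen rel0) mxE.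
case: k l => [[|[|k]] // ?] [[|[|l]] // ?] /=.
- by rewrite (bigD1 j) //= eqxx scale1r big1 ?addr0 // => p /negPf->; rewrite scale0r.
- rewrite (bigD1 a) //= eqxx /= big1 ?addr0 => [|p /negPf->]; last by rewrite scale0r.
  by case: eqP; rewrite ?scale1r ?scale0r.
- by rewrite big1 // => p _; rewrite scale0r.
rewrite (bigD1 j) //= eqxx mul1r big1 ?addr0 // => p /negPf->.
by rewrite mul0r scale0r.
Qed.

(** The three diagonal weights multiply to 1, so powers of the determinant are invariant. *)
Lemma act_detinv : act detinv 0 detinv.
Proof.
apply/matrixP => i j; rewrite !mxE (comul_detinv HDelta) slice_rE /= /root_coord.
rewrite (GLq_eval_detinv rel0) mxE.
by case: i j => [[|[|i]] // ?] [[|[|j]] // ?] /=; rewrite ?scale1r ?scale0r.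
Qed.

(** By [slice_lr], the Haar value of (id (x) T) Delta x equals T applied to (haar (x) id) Delta x =
    haar(x) 1, and T vanishes at 1, being an off-diagonal entry. *)
Lemma haar_act x y z : act x y z -> haar y = 0.
Proof.
move/matrixP/(_ 0 1); rewrite !mxE /= => <-.
by rewrite slice_lr (haar_left Hhaar) linearZ /= root_coord1 mulr0.
Qed.

End Coaction.

(** * q-commuting elements and twisted derivations of powers *)

Section QCommutation.
Variables (K : fieldType) (A : algType K).
Implicit Types (k : K) (a b r : A).

Lemma qcommXr k a b n : a * b = k *: (b * a) ->
  a * b ^+ n = k ^+ n *: (b ^+ n * a).
Proof.
move=> ab; elim: n => [|n ih]; first by rewrite !expr0 scale1r mulr1 mul1r.
by rewrite !exprS mulrA ab -scalerAl -[b * a * _]mulrA ih -scalerAr scalerA mulrA.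
Qed.

Lemma qcommXl k a b n : a * b = k *: (b * a) ->
  a ^+ n * b = k ^+ n *: (b * a ^+ n).
Proof.
move=> ab; elim: n => [|n ih]; first by rewrite !expr0 scale1r mulr1 mul1r.
rewrite [in LHS]exprS -mulrA ih -scalerAr mulrA ab -scalerAl scalerA -mulrA.
by rewrite -exprS -exprSr.
Qed.

Lemma qcomm_sym k a b : k != 0 -> a * b = k *: (b * a) -> b * a = k^-1 *: (a * b).
Proof. by move=> k0 ->; rewrite scalerA mulVf // scale1r. Qed.

Lemma mulCA k a b r : a * b = k *: (b * a) -> a * (b * r) = k *: (b * (a * r)).
Proof. by move=> ab; rewrite mulrA ab -scalerAl mulrA. Qed.

End QCommutation.

(* [D x y z] is to be read as: the twisted derivation attached to [D] maps [x] to
   [y], and its twisting automorphism maps [x] to [z]. *)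
Record twisted_derivation (K : fieldType) (A : algType K) (h : {scalar A})
    (D : A -> A -> A -> Prop) : Prop := {
  derM : forall x y z x' y' z', D x y z -> D x' y' z' ->
    D (x * x') (x * y' + y * z') (z * z');
  der1 : D 1 0 1;
  der_inv : forall x y z, D x y z -> h y = 0
}.

Section TwistedDerivation.
Variables (K : fieldType) (A : algType K) (h : {scalar A}).
Variables (D : A -> A -> A -> Prop) (HD : twisted_derivation h D).

Definition geom (t : K) n := \sum_(r < n) t ^+ r.

Lemma geom0 t : geom t 0 = 0. Proof. exact: big_ord0. Qed.

Lemma geomS t n : geom t n.+1 = 1 + t * geom t n.
Proof.
rewrite /geom big_ord_recl mulr_sumr; congr (_ + _).
by apply: eq_bigr => i _; rewrite exprS.
Qed.

Lemma geomE t n : t != 1 -> geom t n = (1 - t ^+ n) / (1 - t).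
Proof.
move=> t1; have t1' : 1 - t != 0 by rewrite subr_eq0 eq_sym.
elim: n => [|n ih]; first by rewrite geom0 expr0 subrr mul0r.
by rewrite geomS ih exprS; field.
Qed.

(** In each of the [n] Leibniz terms, every [a] to the right of [b] contributes [k] from the twist
    and [l] from moving [b] past it; hence a geometric sum in [k * l]. For [n = 0] the sum vanishes,
    so the truncated [n.-1] is harmless. *)
Lemma der_exp a b k l n : D a b (k *: a) -> b * a = l *: (a * b) ->
  D (a ^+ n) (geom (k * l) n *: (a ^+ n.-1 * b)) (k ^+ n *: a ^+ n).
Proof.
move=> Da ba; elim: n => [|n ih].
  by rewrite geom0 scale0r !expr0 scale1r; apply: der1 HD.
have := derM HD ih Da; rewrite -!scalerAl -!scalerAr !scalerA -!exprSr.
suff -> : a ^+ n * b + (geom (k * l) n * k) *: (a ^+ n.-1 * b * a) =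
  geom (k * l) n.+1 *: (a ^+ n.+1.-1 * b) by [].
rewrite geomS scalerDl scale1r; congr (_ + _).
case: n {ih} => [|n]; first by rewrite geom0 mulr0 mul0r !scale0r.
rewrite /= -mulrA ba -scalerAr scalerA mulrA -exprSr; congr (_ *: _); ring.
Qed.

Lemma der_exp0 a k n : D a 0 (k *: a) -> D (a ^+ n) 0 (k ^+ n *: a ^+ n).
Proof.
move=> Da; have := @der_exp a 0 k 0 n Da; rewrite mul0r !mulr0 !scaler0.
by apply.
Qed.

End TwistedDerivation.

(** * Recursions between Haar values *)

Lemma expSx (R : pzRingType) (w r : R) n : w * (w ^+ n * r) = w ^+ n.+1 * r.
Proof. by rewrite mulrA -exprS. Qed.

Lemma expxS (R : pzRingType) (w r : R) n : w ^+ n * (w * r) = w ^+ n.+1 * r.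
Proof. by rewrite mulrA -exprSr. Qed.

Section Flag.
Variables (K : fieldType) (A : algType K) (h : {scalar A}) (q : K).
Variables (F1 F2 E1 : A -> A -> A -> Prop).

Record row_vector (w0 w1 w2 : A) : Prop := {
  row01 : w0 * w1 = q *: (w1 * w0);
  row02 : w0 * w2 = q *: (w2 * w0);
  row12 : w1 * w2 = q *: (w2 * w1);
  row_F10 : F1 w0 w1 (q^-1 *: w0);
  row_F11 : F1 w1 0 (q *: w1);
  row_F12 : F1 w2 0 (1 *: w2);
  row_F20 : F2 w0 0 (1 *: w0);
  row_F21 : F2 w1 w2 (q^-1 *: w1);
  row_F22 : F2 w2 0 (q *: w2);
  row_E10 : E1 w0 0 (q^-1 *: w0);
  row_E11 : E1 w1 w0 (q *: w1);
  row_E12 : E1 w2 0 (1 *: w2)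
}.

(** The representation dual to that of [row_vector]: the twists are inverse, and the constants [- q]
    and [- q^-1] are those for which x0 y0 + x1 y1 + x2 y2 is killed by the three derivations. *)
Record row_covector (w0 w1 w2 : A) : Prop := {
  cov10 : w1 * w0 = q *: (w0 * w1);
  cov20 : w2 * w0 = q *: (w0 * w2);
  cov21 : w2 * w1 = q *: (w1 * w2);
  cov_F10 : F1 w0 0 (q *: w0);
  cov_F11 : F1 w1 (- q *: w0) (q^-1 *: w1);
  cov_F12 : F1 w2 0 (1 *: w2);
  cov_F20 : F2 w0 0 (1 *: w0);
  cov_F21 : F2 w1 0 (q *: w1);
  cov_F22 : F2 w2 (- q *: w1) (q^-1 *: w2);
  cov_E10 : E1 w0 (- q^-1 *: w1) (q *: w0);
  cov_E11 : E1 w1 0 (q^-1 *: w1);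
  cov_E12 : E1 w2 0 (1 *: w2)
}.

Hypotheses (HF1 : twisted_derivation h F1) (HF2 : twisted_derivation h F2)
  (HE1 : twisted_derivation h E1).
Hypothesis q0 : q != 0.
Variables x0 x1 x2 u0 u1 u2 y0 y1 y2 v0 v1 v2 : A.
Hypotheses (Hx : row_vector x0 x1 x2) (Hv : row_vector v0 v1 v2).
Hypotheses (Hy : row_covector y0 y1 y2) (Hu : row_covector u0 u1 u2).
Hypothesis ux : q ^+ 4 *: (u0 * x0) + q ^+ 2 *: (u1 * x1) + u2 * x2 = 0.
Hypothesis yv : q ^+ 4 *: (y0 * v0) + q ^+ 2 *: (y1 * v1) + y2 * v2 = 0.
Hypothesis xy : x0 * y0 + x1 * y1 + x2 * y2 = 1.
Hypothesis uv : q ^+ 4 *: (u0 * v0) + q ^+ 2 *: (u1 * v1) + u2 * v2 = 1.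

(* [u0] and [v0] do not occur: they are eliminated by [ux] and [yv]. *)
Definition lword a b g d e := u2 ^+ a * (u1 ^+ b * (x0 ^+ g * (x1 ^+ d * x2 ^+ e))).
Definition rword a b g d e := y2 ^+ e * (y1 ^+ d * (y0 ^+ g * (v1 ^+ b * v2 ^+ a))).

Local Notation t := (q^-1 * q^-1).

Ltac qfield := rewrite ?(exprD, exprS, expr0, expr1, exprMn, exprVn) ?expr1n; field;
  rewrite ?expf_neq0 ?q0 //.

Ltac wnorm := rewrite ?(mulr0, mul0r, addr0, add0r, scaler0, expr1n, mul1r, scale1r)
  -?scalerAl -?scalerAr -?scalerAl -?scalerAr ?scalerA -?mulrA.

(** One [x0] is spent to remove [u0] through [ux]; the new [x1] or [x2] then passes the remaining
    [x0 ^+ g]. This is why [F1_lword] asks for at least one [x0]. *)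
Lemma contract_ux g r : u0 * (x0 ^+ g.+1 * r) =
  - (q ^- 2 * q^-1 ^+ g) *: (u1 * (x0 ^+ g * (x1 * r)))
  + - (q ^- 4 * q^-1 ^+ g) *: (u2 * (x0 ^+ g * (x2 * r))).
Proof.
have q4 : q ^+ 4 != 0 by rewrite expf_neq0.
have e : u0 * x0 = - (q ^- 2) *: (u1 * x1) - q ^- 4 *: (u2 * x2).
  apply: (scalerI q4); rewrite scalerDr scalerN !scalerA mulfV // scale1r.
  have -> : q ^+ 4 * - q ^- 2 = - q ^+ 2 by field.
  by move/eqP: ux; rewrite -addrA addr_eq0 opprD scaleNr => /eqP.
have c1 := qcommXr g (qcomm_sym q0 (row01 Hx)).
have c2 := qcommXr g (qcomm_sym q0 (row02 Hx)).
rewrite exprS -mulrA mulrA e mulrDl -scaleNr -!scalerAl -!mulrA.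
by rewrite (mulCA r c1) (mulCA r c2) -!scalerAr !scalerA !mulNr.
Qed.

(** [F1] turns [x0] into [x1] and [u1] into [u0]. The latter is removed by [contract_ux], whose [x1]
    part joins the first term and whose [x2] part is the second. *)
Lemma F1_lword a b g d e : F1 (lword a b g.+1 d e)
  ((q ^+ d * (geom t g.+1 + t ^+ g.+1 * geom t b)) *: lword a b g d.+1 e
    + (geom t b * q^-1 ^+ (g + b + g.+3)) *: lword a.+1 b.-1 g d e.+1)
  ((q ^+ d * q^-1 ^+ (b + g.+1)) *: lword a b g.+1 d e).
Proof.
have du2 := der_exp0 HF1 a (cov_F12 Hu).
have cu : - q *: u0 * u1 = q^-1 *: (u1 * (- q *: u0)).
  by rewrite -scalerAl (qcomm_sym q0 (cov10 Hu)) -scalerAr !scalerA mulrC.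
have du1 := der_exp HF1 b (cov_F11 Hu) cu.
have dx0 := der_exp HF1 g.+1 (row_F10 Hx) (qcomm_sym q0 (row01 Hx)).
have dx1 := der_exp0 HF1 d (row_F11 Hx).
have dx2 := der_exp0 HF1 e (row_F12 Hx).
have := derM HF1 du2 (derM HF1 du1 (derM HF1 dx0 (derM HF1 dx1 dx2))).
wnorm; rewrite mulrDr; wnorm; rewrite contract_ux.
congr F1; last first.
  by congr (_ *: _); rewrite exprD; ring.
(* For [b = 0] there is no [u1] to act on; [geom t 0 = 0] removes the terms with the truncated
   [b.-1]. *)
rewrite /lword; case: b {du1} => [|b] /=.
  rewrite geom0 mulr0 !mul0r !scale0r !addr0 !expSx.
  by congr (_ *: _); ring.
have c21 := qcommXl b (qcomm_sym q0 (cov21 Hu)).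
have cx := qcommXr d (qcomm_sym q0 (row12 Hx)).
rewrite mulrDr; wnorm; rewrite mulrDr scalerDr; wnorm.
rewrite (mulCA _ c21) (mulCA _ cx); wnorm.
rewrite !(expSx, expxS) addrA -scalerDl; congr (_ *: _ + _ *: _).
- qfield.
- qfield.
by rewrite -exprS.
Qed.

Lemma F1_rword a b g d e : F1 (rword a b g d e)
  ((- q ^+ (g + b).+1 * geom t d) *: rword a b g.+1 d.-1 e)
  ((q ^+ (g + b) * q^-1 ^+ d) *: rword a b g d e).
Proof.
have dy2 := der_exp0 HF1 e (cov_F12 Hy).
have cy : - q *: y0 * y1 = q^-1 *: (y1 * (- q *: y0)).
  by rewrite -scalerAl (qcomm_sym q0 (cov10 Hy)) -scalerAr !scalerA mulrC.
have dy1 := der_exp HF1 d (cov_F11 Hy) cy.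
have dy0 := der_exp0 HF1 g (cov_F10 Hy).
have dv1 := der_exp0 HF1 b (row_F11 Hv).
have dv2 := der_exp0 HF1 a (row_F12 Hv).
have := derM HF1 dy2 (derM HF1 dy1 (derM HF1 dy0 (derM HF1 dv1 dv2))).
wnorm; rewrite expSx; congr F1; congr (_ *: _); qfield.
Qed.

Lemma F2_lword a b g d e : F2 (lword a b g d e)
  ((- q ^+ (b + e).+1 * q^-1 ^+ d * geom t a) *: lword a.-1 b.+1 g d e
   + (q ^+ e * geom t d) *: lword a b g d.-1 e.+1)
  ((q ^+ (b + e) * q^-1 ^+ (a + d)) *: lword a b g d e).
Proof.
have cu : - q *: u1 * u2 = q^-1 *: (u2 * (- q *: u1)).
  by rewrite -scalerAl (qcomm_sym q0 (cov21 Hu)) -scalerAr !scalerA mulrC.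
have du2 := der_exp HF2 a (cov_F22 Hu) cu.
have du1 := der_exp0 HF2 b (cov_F21 Hu).
have dx0 := der_exp0 HF2 g (row_F20 Hx).
have dx1 := der_exp HF2 d (row_F21 Hx) (qcomm_sym q0 (row12 Hx)).
have dx2 := der_exp0 HF2 e (row_F22 Hx).
have := derM HF2 du2 (derM HF2 du1 (derM HF2 dx0 (derM HF2 dx1 dx2))).
wnorm; rewrite -?exprS expSx addrC; congr F2; last by congr (_ *: _); qfield.
congr (_ *: _ + _ *: _); qfield.
Qed.

Lemma F2_rword a b g d e : F2 (rword a b g d e)
  ((- q ^+ (d + a).+1 * q^-1 ^+ b * geom t e) *: rword a b g d.+1 e.-1
   + (q ^+ a * geom t b) *: rword a.+1 b.-1 g d e)
  ((q ^+ (d + a) * q^-1 ^+ (e + b)) *: rword a b g d e).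
Proof.
have cy : - q *: y1 * y2 = q^-1 *: (y2 * (- q *: y1)).
  by rewrite -scalerAl (qcomm_sym q0 (cov21 Hy)) -scalerAr !scalerA mulrC.
have dy2 := der_exp HF2 e (cov_F22 Hy) cy.
have dy1 := der_exp0 HF2 d (cov_F21 Hy).
have dy0 := der_exp0 HF2 g (cov_F20 Hy).
have dv1 := der_exp HF2 b (row_F21 Hv) (qcomm_sym q0 (row12 Hv)).
have dv2 := der_exp0 HF2 a (row_F22 Hv).
have := derM HF2 dy2 (derM HF2 dy1 (derM HF2 dy0 (derM HF2 dv1 dv2))).
wnorm; rewrite -?exprS expSx addrC; congr F2; last by congr (_ *: _); qfield.
congr (_ *: _ + _ *: _); qfield.
Qed.

(** [E1] moves only the letters [x1] and [u0], and with [d = 0] neither is present. *)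
Lemma E1_lword a b g e : E1 (lword a b g 0 e) 0
  ((q^-1 ^+ (b + g)) *: lword a b g 0 e).
Proof.
have du2 := der_exp0 HE1 a (cov_E12 Hu).
have du1 := der_exp0 HE1 b (cov_E11 Hu).
have dx0 := der_exp0 HE1 g (row_E10 Hx).
have dx2 := der_exp0 HE1 e (row_E12 Hx).
have := derM HE1 du2 (derM HE1 du1 (derM HE1 dx0 (derM HE1 (der1 HE1) dx2))).
wnorm; rewrite /lword expr0 !mul1r; congr E1; congr (_ *: _); qfield.
Qed.

Lemma contract_yv g r : y0 ^+ g.+1 * (v0 * r) =
  - (q ^- 2 * q^-1 ^+ g) *: (y1 * (y0 ^+ g * (v1 * r)))
  + - (q ^- 4 * q^-1 ^+ g) *: (y2 * (y0 ^+ g * (v2 * r))).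
Proof.
have q4 : q ^+ 4 != 0 by rewrite expf_neq0.
have e : y0 * v0 = - (q ^- 2) *: (y1 * v1) - q ^- 4 *: (y2 * v2).
  apply: (scalerI q4); rewrite scalerDr scalerN !scalerA mulfV // scale1r.
  have -> : q ^+ 4 * - q ^- 2 = - q ^+ 2 by field.
  by move/eqP: yv; rewrite -addrA addr_eq0 opprD scaleNr => /eqP.
have c1 := qcommXl g (qcomm_sym q0 (cov10 Hy)).
have c2 := qcommXl g (qcomm_sym q0 (cov20 Hy)).
rewrite exprSr -mulrA [y0 * (_ * _)]mulrA e mulrDl -scaleNr -!scalerAl -!mulrA.
rewrite mulrDr -!scalerAr (mulCA _ c1) (mulCA _ c2) !scalerA.
by congr (_ *: _ + _ *: _); ring.
Qed.

(** Mirror image of [F1_lword]: [E1] creates [v0] from [v1], and [contract_yv] removes it at the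
    cost of one [y0]. *)
Lemma E1_rword a b g d e : E1 (rword a b g.+1 d e)
  ((- q^-1 ^+ g.+1 * q ^+ b * geom (q * q) g.+1
    - q^-1 ^+ (g + b).+1 * geom (q * q) b) *: rword a b g d.+1 e
   + (- geom (q * q) b * q^-1 ^+ (g + d + b + b) * q^- 2) *: rword a.+1 b.-1 g d e.+1)
  ((q ^+ (g.+1 + b) * q^-1 ^+ d) *: rword a b g.+1 d e).
Proof.
have dy2 := der_exp0 HE1 e (cov_E12 Hy).
have dy1 := der_exp0 HE1 d (cov_E11 Hy).
have cy : - q^-1 *: y1 * y0 = q *: (y0 * (- q^-1 *: y1)).
  by rewrite -scalerAl (cov10 Hy) -scalerAr !scalerA mulrC.
have dy0 := der_exp HE1 g.+1 (cov_E10 Hy) cy.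
have dv1 := der_exp HE1 b (row_E11 Hv) (row01 Hv).
have dv2 := der_exp0 HE1 a (row_E12 Hv).
have := derM HE1 dy2 (derM HE1 dy1 (derM HE1 dy0 (derM HE1 dv1 dv2))).
have cg := qcommXl g (qcomm_sym q0 (cov10 Hy)).
wnorm; rewrite /= (mulCA _ cg); wnorm; rewrite !mulrDr; wnorm.
rewrite expxS; congr E1; last by congr (_ *: _); qfield.
case: b {dv1} => [|b] /=.
  rewrite geom0 !scale0r !(mul0r, mulr0) !oppr0 !mul0r !scale0r !(addr0, add0r) expr0.
  by congr (_ *: _); qfield.
have cv := qcommXl b (qcomm_sym q0 (row01 Hv)).
have cy2 := qcommXl d (qcomm_sym q0 (cov21 Hy)).
have cv2 := qcommXr b (qcomm_sym q0 (row12 Hv)).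
rewrite (mulCA _ cv); wnorm; rewrite contract_yv !(mulCA _ cv2); wnorm.
do 3 (rewrite ?mulrDr ?scalerDr; wnorm).
rewrite (mulCA _ cy2); wnorm; rewrite !(expSx, expxS) -?exprS addrAC -scalerDl.
congr (_ *: _ + _ *: _); qfield.
Qed.

Hypothesis q2_neq1 : q ^+ 2 != 1.
Local Notation p := (q ^+ 2).

Lemma subr_p_neq0 : 1 - q * q != 0. Proof. by rewrite -expr2 subr_eq0 eq_sym. Qed.

Ltac pfield := rewrite ?(mulSn, mul0n, addn0, add0n, exprD, exprS, expr0, expr1, exprMn, exprVn)
    ?expr1n ?mulr1; field; rewrite ?expf_neq0 ?q0 ?subr_p_neq0 //.

Lemma geom_pV n : geom t n = p * (1 - p ^+ n) / (p ^+ n * (1 - p)).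
Proof.
have pn0 : p ^+ n != 0 by rewrite !expf_neq0.
have tp : t = p^-1 by field.
have p1 : 1 - p != 0 := subr_p_neq0.
have q0' : q ^+ n != 0 by rewrite expf_neq0.
rewrite tp geomE ?invr_eq1 // exprVn; field.
by rewrite q0 pn0 p1 -opprB oppr_eq0 p1.
Qed.

Lemma geom_p n : geom (q * q) n = (1 - p ^+ n) / (1 - p).
Proof. by rewrite -expr2 geomE. Qed.

Lemma haar_der D x y z x' y' z' : twisted_derivation h D -> D x y z -> D x' y' z' ->
  h (x * y') + h (y * z') = 0.
Proof. by move=> HD d d'; rewrite -linearD; apply: der_inv (derM HD d d'). Qed.

Lemma haar_F1 a b g d e a' b' g' d' e' :
  q ^+ (d + b + 1 + d') * (1 - p ^+ (g + 1 + b)) *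
    h (lword a b g d.+1 e * rword a' b' g' d' e')
  + q ^+ d' * (1 - p ^+ b) * h (lword a.+1 b.-1 g d e.+1 * rword a' b' g' d' e')
  = q ^+ (4 + 2 * g + 3 * b) * (1 - p ^+ d') *
    h (lword a b g.+1 d e * rword a' b' g'.+1 d'.-1 e').
Proof.
have := haar_der HF1 (F1_lword a b g d e) (F1_rword a' b' g' d' e').
rewrite -!scalerAr mulrDl -!scalerAl linearZ /= linearZ linearD /= !linearZ /=.
set h1 := h (lword a b g d.+1 e * _); set h2 := h (lword a.+1 _ _ _ _ * _); set h3 := h _.
move=> H; apply: subr0_inj.
apply: (etrans _ (mulr0 (q ^+ (1 + d' + 2 * g + 3 * b + d') * (1 - p) * q ^- (g' + b')))).
by rewrite -H !geom_pV; pfield.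
Qed.

Lemma haar_E1 a' b' g' e' a b g d e :
  q ^+ (b + d + 1) * (1 - p ^+ (g + 1 + b)) *
    h (lword a' b' g' 0 e' * rword a b g d.+1 e)
  + (1 - p ^+ b) * h (lword a' b' g' 0 e' * rword a.+1 b.-1 g d e.+1) = 0.
Proof.
have := haar_der HE1 (E1_lword a' b' g' e') (E1_rword a b g d e).
rewrite mul0r linear0 addr0 mulrDr -!scalerAr linearD /= !linearZ /=.
set h1 := h (_ * rword _ _ _ _.+1 _); set h2 := h _.
move=> H; apply: (etrans _ (mulr0 (- q ^+ (g + b + d + b + 2) * (1 - p)))).
by rewrite -H !geom_p; pfield.
Qed.

Lemma haar_F2 a b g d e a' b' g' d' e' :
  q ^+ (d' + a') * q^-1 ^+ (e' + b') *
    (q ^+ e * geom t d * h (lword a b g d.-1 e.+1 * rword a' b' g' d' e')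
     - q ^+ (b + e).+1 * q^-1 ^+ d * geom t a *
       h (lword a.-1 b.+1 g d e * rword a' b' g' d' e'))
  = q ^+ (d' + a').+1 * q^-1 ^+ b' * geom t e' *
      h (lword a b g d e * rword a' b' g' d'.+1 e'.-1)
    - q ^+ a' * geom t b' * h (lword a b g d e * rword a'.+1 b'.-1 g' d' e').
Proof.
have := haar_der HF2 (F2_lword a b g d e) (F2_rword a' b' g' d' e').
rewrite mulrDl mulrDr -!scalerAr -!scalerAl linearD /= !linearZ /= linearD /= !linearZ /=.
move=> H; apply: subr0_inj; rewrite -[RHS]H; ring.
Qed.

(** [F2] is applied to a left and a right word differing by one exchange of [h] and [k], so that
    both diagonal entries occur. The third term, in which a [y2] became [y1], is brought back to the
    second diagonal entry by [haar_E1]. *)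
Lemma haar_shift_hk a b g e :
  p ^+ (b + e) * (1 - p ^+ a.+1) * (1 - p ^+ (g + b + 2)) *
    h (lword a b.+1 g 0 e * rword a b.+1 g 0 e) =
  p ^+ a * (1 - p ^+ b.+1) * (1 - p ^+ (g + b + 2 + e)) *
    h (lword a.+1 b g 0 e * rword a.+1 b g 0 e).
Proof.
have := haar_F2 a.+1 b g 0 e a b.+1 g 0 e.
rewrite geom0 !mulr0 mul0r sub0r /=.
set h1 := h (lword a b.+1 _ _ _ * _); set h2 := h (_ * rword a.+1 _ _ _ _).
case: e @h1 @h2 => [|e] h1 h2.
  rewrite geom0 !(mulr0, mul0r) sub0r => H.
  apply: subr0_inj.
  rewrite -[RHS](mulr0 (- p ^+ (a + b) * q ^- a * (1 - p) * (1 - p ^+ (g + b + 2)))).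
  by rewrite -(eq_subr0 H) !geom_pV; pfield.
have := haar_E1 a.+1 b g e.+1 a b.+1 g 0 e.
rewrite /= -/h2; set h3 := h (lword _ _ _ _ _ * rword a _ _ _ _) => HE HF.
apply: subr0_inj.
apply: (etrans _ (lincomb2_eq0 (- p ^+ (b + e.+1 + a) * q ^- a * (1 - p) * (1 - p ^+ (g + b + 2)))
  (- p ^+ a * (1 - p ^+ e.+1)) (eq_subr0 HF) HE)).
by rewrite !geom_pV; pfield.
Qed.

(** [F2], applied to a left word with one [x1] and a right word with one more [y2], links [hA], [hB]
    and [hX]. Two instances of [F1] then express [hB] through [hC] and [hX] through [hA]. *)
Lemma haar_shift_c m g e :
  p ^+ e * (1 - p ^+ (g + 2 + m)) * (1 - p ^+ g.+1) *
    h (lword m 0 g 0 e.+1 * rword m 0 g 0 e.+1) =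
  p ^+ (2 + g + m) * (1 - p ^+ e.+1) * (1 - p ^+ (g + 2)) *
    h (lword m 0 g.+1 0 e * rword m 0 g.+1 0 e).
Proof.
have := haar_F2 m 0 g 1 e m 0 g 0 e.+1; have := haar_F1 m 0 g 0 e m 0 g 1 e.
have := haar_F1 m.-1 1 g 0 e m 0 g 0 e.+1; rewrite /= geom0 expr0 subrr.
set hX := h (lword m.-1 _ _ _ _ * _); set hA := h (lword m 0 g 0 e.+1 * _).
set hB := h (lword m 0 g 1 e * _); set hC := h (lword m 0 g.+1 0 e * _).
rewrite !(mulr0, mul0r, addr0, subr0) => Ha Hb Hf.
(* For [m = 0] the word with [m.-1.+1] is not the one in [hA], so [Ha] says nothing about it. The
   factor [1 - p ^+ m], which accompanies [hX] in [Hf], covers this case. *)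
have Ha' : (1 - p ^+ m) * (q ^+ 2 * (1 - p ^+ (g + 2)) * hX + (1 - p) * hA) = 0.
  case: m @hX @hA @hB @hC Ha {Hb Hf} => [|m] hX hA hB hC /= Ha; first by rewrite expr0 subrr mul0r.
  by rewrite -[RHS](mulr0 (1 - p ^+ m.+1)) -Ha; pfield.
apply: subr0_inj.
apply: (etrans _ (lincomb3_eq0 (p ^+ (e + m) * (1 - p ^+ (g + 2)) * (1 - p ^+ g.+1) * q * q ^- m)
  (p ^+ e * (1 - p ^+ g.+1) / (1 - p)) (p ^+ m * (1 - p ^+ (g + 2)) * (1 - p ^+ e.+1) / (1 - p))
  (eq_subr0 Hf) Ha' (eq_subr0 Hb))).
by rewrite !geom_pV; pfield.
Qed.

Definition hvec m n := h (lword m 0 n 0 0 * rword m 0 n 0 0).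

(** The unit relation [xy] is inserted where the left word ends and the right word begins. *)
Lemma hvec_split_x m n : hvec m n = hvec m n.+1
  + h (lword m 0 n 1 0 * rword m 0 n 1 0) + h (lword m 0 n 0 1 * rword m 0 n 0 1).
Proof.
rewrite /hvec -!linearD /=; congr (h _); rewrite /lword /rword !(expr0, expr1, mul1r, mulr1).
rewrite -[y0 ^+ n in LHS]mul1r -[in LHS]xy -!mulrA !mulrDl !mulrDr -!mulrA.
by rewrite !(expSx, expxS).
Qed.

(** Of the three summands of [hvec_split_x], the one with [x1] is a multiple of [hvec m n.+1] by
    [haar_F1], and so is the one with [x2] by [haar_shift_c]. *)
Lemma hvec_recx m n :
  (1 - p ^+ n.+1) * (1 - p ^+ (n + m + 2)) * hvec m n =
  (1 - p ^+ (n + 2)) * (1 - p ^+ (n + m + 3)) * hvec m n.+1.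
Proof.
have := haar_shift_c m n 0; have := haar_F1 m 0 n 0 0 m 0 n 1 0.
rewrite hvec_split_x /= -/(hvec m n.+1).
set hA := h (lword m 0 n 0 1 * _); set hB := h (lword m 0 n 1 0 * _).
rewrite expr0 subrr !(mulr0, mul0r, addr0) => Hb Ha.
apply: subr0_inj.
apply: (etrans _ (lincomb2_eq0 ((1 - p ^+ (n + m + 2)) / p) 1 (eq_subr0 Hb) (eq_subr0 Ha))).
by pfield.
Qed.

(** Same device with the relation [uv]. It can be inserted because, for [n = 0], the powers of [u2]
    and [v2] meet in the middle. *)
Lemma hvec_recu m : 1 - p ^+ 2 != 0 ->
  (1 - p ^+ m.+1) * hvec m 0 = (1 - p ^+ (m + 3)) * hvec m.+1 0.
Proof.
move=> p2; have := haar_shift_hk m 0 0 0; rewrite -/(hvec m.+1 0).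
set h1 := h _ => H1.
(* The summand with [u0 v0] is not a pairing of admissible words; [F1] applied to u2^m u1 and v0
   v2^m identifies it with the one with [u1 v1]. *)
have H0 : h (u2 ^+ m * (u0 * (v0 * v2 ^+ m))) = h1.
  have du2 := der_exp0 HF1 m (cov_F12 Hu).
  have dv2 := der_exp0 HF1 m (row_F12 Hv).
  have := haar_der HF1 (derM HF1 du2 (cov_F11 Hu)) (derM HF1 (row_F10 Hv) dv2).
  wnorm; rewrite linearZ /= mulrN mulVf // mulN1r => /subr0_inj <-.
  by rewrite /h1 /lword /rword !(expr0, expr1, mul1r, mulr1) -mulrA.
have Huv : hvec m 0 = q ^+ 4 * h1 + q ^+ 2 * h1 + hvec m.+1 0.
  rewrite -[X in q ^+ 4 * X]H0 /h1 /hvec -!linearZ -!linearD /=; congr (h _).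
  rewrite /lword /rword !(expr0, expr1, mul1r, mulr1).
  rewrite -[v2 ^+ m in LHS]mul1r -[in LHS]uv !mulrDl !mulrDr -!scalerAl -!scalerAr -!mulrA.
  by rewrite !(expSx, expxS) -exprS.
have p2' : 1 - q * q * (q * q) != 0 by have := p2; rewrite !expr2.
apply: subr0_inj.
apply: (etrans _ (lincomb2_eq0 (1 - p ^+ m.+1) ((p + p ^+ 2) / (1 - p ^+ 2))
  (eq_subr0 Huv) (eq_subr0 H1))).
by pfield.
Qed.

End Flag.

(** * q-series *)

Section QSeries.
Variables (K : fieldType) (p : K).
Hypothesis p_neq0 : p != 0.
Hypothesis p_root : forall n, 1 - p ^+ n.+1 != 0.

Local Notation f := (qpoch p p).

Lemma qpoch0 (x : K) : qpoch x p 0 = 1. Proof. exact: big_ord0. Qed.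

Lemma qpochS (x : K) n : qpoch x p n.+1 = qpoch x p n * (1 - x * p ^+ n).
Proof. by rewrite /qpoch big_ord_recr. Qed.

Lemma qpochSl (x : K) n : qpoch x p n.+1 = (1 - x) * qpoch (x * p) p n.
Proof.
rewrite /qpoch big_ord_recl expr0 mulr1; congr (_ * _).
by apply: eq_bigr => i _; rewrite exprS mulrA.
Qed.

Lemma qpoch_cat (x : K) m n : qpoch x p (m + n) = qpoch x p m * qpoch (x * p ^+ m) p n.
Proof.
elim: n => [|n ih]; first by rewrite addn0 qpoch0 mulr1.
by rewrite addnS !qpochS ih exprD !mulrA.
Qed.

Lemma qfactS n : f n.+1 = f n * (1 - p ^+ n.+1).
Proof. by rewrite qpochS exprS. Qed.

Lemma qfact_neq0 n : f n != 0.
Proof. by elim: n => [|n ih]; rewrite ?qpoch0 ?oner_neq0 // qfactS mulf_neq0. Qed.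

Lemma qbinom0 n : qbinom p n 0 = 1.
Proof. by rewrite /qbinom leq0n qpoch0 mul1r subn0 divff ?qfact_neq0. Qed.

Lemma qbinom_small n j : (n < j)%N -> qbinom p n j = 0.
Proof. by move=> nj; rewrite /qbinom leqNgt nj. Qed.

Lemma qbinomE a b : qbinom p (a + b) a = f (a + b) / (f a * f b).
Proof. by rewrite /qbinom leq_addr addKn. Qed.

Lemma qbinom_r a b : qbinom p (a + b) a.+1 = qbinom p (a + b) a * (1 - p ^+ b) / (1 - p ^+ a.+1).
Proof.
case: b => [|b]; first by rewrite addn0 expr0 subrr mulr0 mul0r qbinom_small.
rewrite {1}addnS -addSn !qbinomE -addSnnS !qfactS; field.
by rewrite !qfact_neq0 !p_root.
Qed.

Lemma qbinomSS n j : qbinom p n.+1 j.+1 = qbinom p n j * (1 - p ^+ n.+1) / (1 - p ^+ j.+1).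
Proof.
have [nj|jn] := ltnP n j; first by rewrite !qbinom_small ?mul0r.
rewrite -(subnKC jn) -addSn !qbinomE addSn !qfactS; field.
by rewrite !qfact_neq0 !p_root.
Qed.

Lemma qbinom_pascal n j :
  qbinom p n.+1 j.+1 = qbinom p n j.+1 + p ^+ (n - j) * qbinom p n j.
Proof.
have [nj|jn] := ltnP n j; first by rewrite !qbinom_small ?mulr0 ?addr0 // ltnW.
rewrite qbinomSS -(subnKC jn) addKn qbinom_r.
by have := p_root j; rewrite !exprS exprD => nz; field.
Qed.

(** * The q-Saalschuetz summation by creative telescoping *)

Section Saalschuetz.
Variable z : K.
Hypothesis z_neq : forall i, 1 - z * p ^+ i != 0.

Lemma qpochz_neq0 i n : qpoch (z * p ^+ i) p n != 0.
Proof.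
elim: n => [|n ih]; first by rewrite qpoch0 oner_neq0.
by rewrite qpochS mulf_neq0 // -mulrA -exprD.
Qed.

(** Up to a factor free of [j], the term of the balanced series 3phi2(p^-d, p^-n, p^(-d-n-c)/z;
    p^(-d-n-c), p^(1-d-n)/z; p, p). *)
Definition saal_term d n c j := (-1) ^+ j * p ^+ 'C(j, 2) * qbinom p d j * qbinom p n j
  * f j * f (d + n + c - j) / qpoch (z * p ^+ (d + n - j)) p c.+1.

Lemma saal_term0 d n c :
  saal_term d n c 0 = f (d + n + c) / qpoch (z * p ^+ (d + n)) p c.+1.
Proof. by rewrite /saal_term !subn0 !qbinom0 qpoch0 bin0n !expr0 !mul1r. Qed.

(* Telescoping certificate for the recursion [saal_shift]. *)
Definition saal_cert d n c j := if j is i.+1 then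
  p ^+ i * (1 - p ^+ (n - i)) * (1 - z * p ^+ (d + n + c + 1 - i)) * saal_term d n c.+1 i
  else 0.

Lemma saal_cert_step d n c j : (j <= n)%N ->
  (1 - p ^+ (n + c + 1)) * saal_term d.+1 n c j
  - p ^+ n * (1 - p ^+ c.+1) * (1 - z * p ^+ d) * saal_term d n c.+1 j
  = saal_cert d n c j.+1 - saal_cert d n c j.
Proof.
case: j => [_|i ilt].
  rewrite /saal_cert !saal_term0 expr0 !subn0 subr0 mul1r.
  have eQ : z * p ^+ (d.+1 + n) = z * p ^+ (d + n) * p by rewrite addSn exprSr mulrA.
  rewrite eQ [qpoch _ _ c.+2]qpochSl !addSn !addnS addn0.
  have := z_neq (d + n); have := qpochz_neq0 (d + n).+1 c.+1.
  rewrite exprSr mulrA; set Q := qpoch _ _ _; set F := f _ => Q0 z0.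
  by move: z0; rewrite !exprS !exprD => z0; field; rewrite Q0 z0.
have ein : (i + (n - i.+1)).+1 = n by lia.
have [di|id] := ltnP d i.
  rewrite /saal_cert /saal_term !(@qbinom_small d) ?(@qbinom_small d.+1) //; last by lia.
  by rewrite !(mulr0, mul0r) subrr.
have eid : (i + (d - i))%N = d by lia.
(* Writing d = i + e and n = i + m + 1 removes every truncated subtraction; all terms become
   rational multiples of one common product. *)
move: (n - i.+1)%N (d - i)%N ein eid => m e <- <- {ilt id d n}.
rewrite /saal_cert /saal_term binS bin1 exprD.
have -> : ((i + e).+1 + (i + m).+1 + c - i.+1 = (e + i + m + c).+1)%N by lia.
have -> : ((i + e).+1 + (i + m).+1 - i.+1 = (e + i + m).+1)%N by lia.
have -> : (i + e + (i + m).+1 + c.+1 - i.+1 = (e + i + m + c).+1)%N by lia.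
have -> : (i + e + (i + m).+1 - i.+1 = e + i + m)%N by lia.
have -> : (i + e + (i + m).+1 + c.+1 - i = (e + i + m + c).+2)%N by lia.
have -> : (i + e + (i + m).+1 - i = (e + i + m).+1)%N by lia.
have -> : (i + e + (i + m).+1 + c + 1 - i.+1 = (e + i + m + c).+1)%N by lia.
have -> : (i + e + (i + m).+1 + c + 1 - i = (e + i + m + c).+2)%N by lia.
have -> : ((i + m).+1 - i = m.+1)%N by lia.
have -> : ((i + m).+1 - i.+1 = m)%N by lia.
rewrite qbinomSS -[(i + m).+1]addnS !qbinom_r.
have eQ : z * p ^+ (e + i + m).+1 = z * p ^+ (e + i + m) * p by rewrite exprSr mulrA.
have := z_neq (e + i + m); have := z_neq (e + i + m + c).+2.
have := qpochz_neq0 (e + i + m).+1 c.+1; have := p_root i.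
rewrite [qpoch (z * p ^+ (e + i + m)) _ _]qpochSl -eQ.
rewrite [qpoch (z * p ^+ (e + i + m).+1) _ c.+2]qpochS.
set Q := qpoch _ _ _; rewrite !qfactS -!mulrA -exprD.
set F := f (_ + c); set D := qbinom _ _ _; set N := qbinom _ _ _; set G := f i.
rewrite !(exprD, exprS, expr0, mulr1) => p0 Q0 z1 z0.
field; rewrite Q0 z0 p0 !andbT; apply: contra z1 => /eqP <-; apply/eqP; ring.
Qed.

Lemma saal_shift d n c :
  (1 - p ^+ (n + c + 1)) * \sum_(j < n.+1) saal_term d.+1 n c j
  = p ^+ n * (1 - p ^+ c.+1) * (1 - z * p ^+ d) * \sum_(j < n.+1) saal_term d n c.+1 j.
Proof.
apply/eqP; rewrite -subr_eq0 !mulr_sumr -sumrB.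
under eq_bigr => j _ do rewrite saal_cert_step -1?ltnS //.
rewrite -(big_mkord xpredT (fun j => saal_cert d n c j.+1 - saal_cert d n c j)).
(* The certificate is 0 at [0] by definition and at [n.+1] through its factor [1 - p ^+ (n - n)]. *)
by rewrite telescope_sumr //= subnn expr0 subrr mulr0 !mul0r subr0.
Qed.

(* The induction trades [d] for [c]. *)
Lemma saal_sum d n c : \sum_(j < n.+1) saal_term d n c j =
  p ^+ (d * n) * f (d + c) * f (n + c) / f c
  * qpoch z p d * qpoch z p n / qpoch z p (d + n + c).+1.
Proof.
elim: d c => [|d ih] c.
  rewrite big_ord_recl saal_term0 big1 => [|j _]; last first.
    by rewrite /saal_term [qbinom p 0 _]qbinom_small // !(mulr0, mul0r).
  rewrite addr0 mul0n expr0 mul1r !add0n qpoch0 mulr1.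
  rewrite -addnS [qpoch z p (_ + _)]qpoch_cat.
  have := qpochz_neq0 n c.+1; have := qpochz_neq0 0 n; rewrite expr0 mulr1 => Q1 Q2.
  have F0 := qfact_neq0 c. by field; rewrite F0 Q1 Q2.
have nz := p_root (n + c); apply: (mulfI nz).
have := saal_shift d n c; rewrite addn1 /= => ->.
rewrite ih mulSn [p ^+ (n + d * n)]exprD !addSn !addnS.
rewrite !qfactS [qpoch z p d.+1]qpochS.
have := qpochz_neq0 0 (d + n + c).+2; rewrite expr0 mulr1.
set Q := qpoch z p _.+2 => Q0.
have := p_root c; set P := p ^+ c.+1 => P0.
by field; rewrite qfact_neq0 Q0 P0.
Qed.

End Saalschuetz.

(** * Contiguity relation for the inner sum *)

Definition inner_sum n c M w := \sum_(i < n.+1)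
  w ^+ i * f (c + i) * f (M - i) * qbinom p n i.

(** All three sums are rewritten over the common terms [T i], with q-Pascal for the one of length
    [n.+2]. What remains is an identity of coefficients, valid up to the single index shift [shift];
    the hypothesis on [D] makes the powers of [w] and [p] match. *)
Lemma inner_sum_shift n c M w D : (n <= M)%N -> w * p ^+ n = D * p ^+ M.+1 ->
  (1 - p ^+ c.+1 * D) * inner_sum n.+1 c M.+1 w - (1 - D) * inner_sum n c M.+1 w
  = D * (1 - p ^+ c.+1 * w) * inner_sum n c.+1 M w.
Proof.
move=> nM wD.
pose T i := w ^+ i * f (c + i) * f (M - i) * qbinom p n i.
have e1 : inner_sum n c M.+1 w = \sum_(i < n.+1) T i * (1 - p ^+ (M.+1 - i)).
  apply: eq_bigr => i _; rewrite /T subSn; last by have := ltn_ord i; lia.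
  by rewrite qfactS; ring.
have e2 : inner_sum n c.+1 M w = \sum_(i < n.+1) T i * (1 - p ^+ (c + i).+1).
  by apply: eq_bigr => i _; rewrite /T addSn qfactS; ring.
have e3 : inner_sum n.+1 c M.+1 w = \sum_(i < n.+1) T i * (1 - p ^+ (M.+1 - i))
  + \sum_(i < n.+1) T i * (p ^+ (n - i) * w * (1 - p ^+ (c + i).+1)).
  pose g i := w ^+ i * f (c + i) * f (M.+1 - i) * qbinom p n i.
  have -> : \sum_(i < n.+1) T i * (1 - p ^+ (M.+1 - i)) = g 0 + \sum_(i < n.+1) g i.+1.
    rewrite -e1 /inner_sum [RHS](_ : _ = \sum_(i < n.+2) g i); last by rewrite [RHS]big_ord_recl.
    by rewrite [RHS]big_ord_recr /= /g qbinom_small // mulr0 addr0.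
  rewrite -addrA -big_split /inner_sum big_ord_recl /= qbinom0; congr (_ + _).
    by rewrite /g qbinom0.
  apply: eq_bigr => i _.
  rewrite /bump add1n /g /T qbinom_pascal subSS addnS qfactS [w ^+ i.+1]exprS.
  ring.
(* The two sides are reindexings of each other: the last term on the left and the first on the right
   vanish. *)
have shift : \sum_(i < n.+1) T i * (w * (1 - p ^+ (n - i)) * (1 - p ^+ (c + i).+1))
  = \sum_(i < n.+1) T i * ((1 - p ^+ i) * (1 - p ^+ (M.+1 - i))).
  rewrite big_ord_recr big_ord_recl /= subnn expr0 subrr !(mulr0, mul0r) addr0 add0r.
  apply: eq_bigr => i _; rewrite /bump add1n /T subSS addnS qfactS [w ^+ i.+1]exprS.
  have im : (i < M)%N by have := ltn_ord i; lia.
  have -> : (M - i = (M - i.+1).+1)%N by lia.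
  rewrite qfactS -[X in qbinom p X i.+1](subnKC (ltnW (ltn_ord i))) qbinom_r.
  rewrite subnKC; last exact: ltnW.
  have := p_root i; set P := p ^+ i.+1 => P0; field.
  by rewrite P0.
rewrite e1 e2 e3 mulrDr !mulr_sumr -!big_split -sumrB /=.
(* The same quantity, in its two forms given by [shift], is added to both sides; afterwards the
   equality holds term by term. *)
apply: (@addIr _ (D * p ^+ c.+1 * \sum_(i < n.+1) T i * ((1 - p ^+ i) * (1 - p ^+ (M.+1 - i))))).
rewrite -{2}shift !mulr_sumr -!big_split /=; apply: eq_bigr => i _.
have wi : w * p ^+ (n - i) = D * p ^+ (M.+1 - i).
  have pi0 : p ^+ i != 0 by rewrite expf_neq0.
  apply: (mulIf pi0); rewrite -!mulrA -!exprD !subnK //; have := ltn_ord i; lia.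
have -> : p ^+ (c + i).+1 = p ^+ c.+1 * p ^+ i by rewrite -exprD addSn.
by rewrite [w * (1 - _)]mulrBr [p ^+ (n - i) * w]mulrC wi; ring.
Qed.

End QSeries.

(** * Solving the recursions *)

Section Formula.
Variables (K : fieldType) (q : K).
Local Notation p := (q ^+ 2).

Definition haar_prefactor (d1 d2 c1 c2 c3 : nat) : K :=
  (1 - p) ^+ 2 * (1 - q ^+ 4) * qpoch p p d2 * qpoch p p c2
  / (qpoch p p (d1 + d2 + 1)%N * qpoch p p (c1 + c2 + c3 + 1)%N).

Definition haar_summand (d1 d2 c1 c2 c3 k j : nat) : K :=
  (-1) ^+ j * q ^+ (j ^ 2 - j) * qbinom p d1 j * qbinom p c3 j * qpoch p p j
  / qpoch (q ^+ (2 * d1 + 2 * d2 + 2 * c1 + 2 * c3 - 2 * j + 4)) p (c2 + 1)%N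
  * \sum_(0 <= i < (c2 - k).+1)
      (q ^+ ((2 * d1 + 2 * d2 + 2 * c3 - 2 * j + 2) * i)
       * qpoch p p (c1 + i)%N * qpoch p p (d1 + c2 + c3 - j - i)%N
       * qbinom p (c2 - k)%N i).

(** Stated over any field: the recursions live at the complex image of [q], the theorem at the real
    [q]. *)
Definition haar_formula (d1 d2 c1 c2 c3 k : nat) : K :=
  (-1) ^+ k
  * q ^+ (2 * d1 * d2 + 2 * c1 * c2 + 2 * c1 * c3 + 2 * c2 * c3
          + 2 * c2 + 4 * c3 + k * (d2 + c2 - k + 1))
  * haar_prefactor d1 d2 c1 c2 c3
  * \sum_(0 <= j < c3.+1) haar_summand d1 d2 c1 c2 c3 k j.

Hypothesis q0 : q != 0.
Hypothesis p_root : forall n, 1 - p ^+ n.+1 != 0.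

Local Notation f := (qpoch p p).

Lemma p_neq0 : p != 0. Proof. by rewrite expf_neq0. Qed.

Lemma expr2n n : p ^+ n = q ^+ (2 * n). Proof. by rewrite exprM. Qed.

(** The exponent of the formula at [k = c2], plus [2 * d1 * c3] from the power of [p] in the
    Saalschuetz sum. *)
Definition top_exp d1 d2 c1 c2 c3 := (2 * d1 * d2 + 2 * c1 * c2 + 2 * c1 * c3
  + 2 * c2 * c3 + 2 * c2 + 4 * c3 + c2 * (d2 + 1) + 2 * d1 * c3)%N.

Definition top_prod d1 d2 c1 c2 c3 : K :=
  f d2 * f c1 * f (d1 + c2) * f (c3 + c2) * f (d1 + d2 + c1 + 1) * f (d2 + c1 + c3 + 1)
  / (f (d1 + d2 + 1) * f (c1 + c2 + c3 + 1) * f (d2 + c1 + 1)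
     * f (d1 + d2 + c1 + c2 + c3 + 2)).

Definition top_formula d1 d2 c1 c2 c3 : K :=
  (-1) ^+ c2 * q ^+ top_exp d1 d2 c1 c2 c3 * ((1 - p) ^+ 2 * (1 - q ^+ 4))
  * top_prod d1 d2 c1 c2 c3.

Lemma double_bin2 j : (2 * 'C(j, 2) = j ^ 2 - j)%N.
Proof. by elim: j => // j ih; rewrite binS bin1 mulnDr ih; nia. Qed.

Lemma qpoch_qfact m n : qpoch (p ^+ m.+1) p n = f (m + n) / f m.
Proof. by rewrite qpoch_cat -exprS mulrAC divff ?mul1r // qfact_neq0. Qed.

Lemma haar_formula_top d1 d2 c1 c2 c3 :
  haar_formula d1 d2 c1 c2 c3 c2 = top_formula d1 d2 c1 c2 c3.
Proof.
(* This [z] makes the q-Pochhammer denominator of the formula start at [z * p ^+ (d1 + c3 - j)], as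
   in [saal_term] with [d = d1], [n = c3], [c = c2]. *)
pose z : K := p ^+ (d2 + c1 + 1).+1.
have z_neq i : 1 - z * p ^+ i != 0 by rewrite /z -exprD addSn.
rewrite /haar_formula big_mkord.
rewrite (eq_bigr (fun j : 'I__ => f c1 * saal_term p z d1 c3 c2 j)); last first.
  move=> j _; rewrite /haar_summand /saal_term subnn big_nat1 muln0 expr0 mul1r qbinom0 //.
  rewrite addn0 subn0 mulr1 expr2n double_bin2 /z -exprD expr2n.
  have -> : (2 * d1 + 2 * d2 + 2 * c1 + 2 * c3 - 2 * j + 4 =
    2 * ((d2 + c1 + 1).+1 + (d1 + c3 - j)))%N by have := ltn_ord j; lia.
  have -> : (d1 + c3 + c2 - j = d1 + c2 + c3 - j)%N by lia.
  by rewrite [(c2 + 1)%N]addn1; ring.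
rewrite -mulr_sumr saal_sum ?p_neq0 // /z !qpoch_qfact.
rewrite /top_formula /top_prod /top_exp /haar_prefactor.
have -> : (d2 + c1 + 1 + d1 = d1 + d2 + c1 + 1)%N by lia.
have -> : (d2 + c1 + 1 + c3 = d2 + c1 + c3 + 1)%N by lia.
have -> : (d2 + c1 + 1 + (d1 + c3 + c2).+1 = d1 + d2 + c1 + c2 + c3 + 2)%N by lia.
have -> : (d2 + c2 - c2 + 1 = d2 + 1)%N by lia.
rewrite [q ^+ (_ + 2 * d1 * c3)]exprD -[(2 * d1 * c3)%N]mulnA -[q ^+ (2 * (d1 * c3))]expr2n.
set E := q ^+ (_ + c2 * _).
field.
by rewrite !qfact_neq0.
Qed.

Lemma f_neq0 n : f n != 0. Proof. exact: qfact_neq0. Qed.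

(** Counterpart of [haar_shift_c]. Here and in the next two lemmas the powers of [q] ([E]) and the
    q-factorials ([M]) are compared separately. *)
Lemma top_formula_shift_c m g e :
  p ^+ e * (1 - p ^+ (g + 2 + m)) * (1 - p ^+ g.+1) * top_formula m 0 g 0 e.+1 =
  p ^+ (2 + g + m) * (1 - p ^+ e.+1) * (1 - p ^+ (g + 2)) * top_formula m 0 g.+1 0 e.
Proof.
have E : p ^+ e * q ^+ top_exp m 0 g 0 e.+1 = p ^+ (2 + g + m) * q ^+ top_exp m 0 g.+1 0 e.
  by rewrite !expr2n -!exprD; congr (q ^+ _); rewrite /top_exp; nia.
have M : (1 - p ^+ (g + 2 + m)) * (1 - p ^+ g.+1) * top_prod m 0 g 0 e.+1 =
  (1 - p ^+ e.+1) * (1 - p ^+ (g + 2)) * top_prod m 0 g.+1 0 e.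
  rewrite /top_prod (addnAC g 2 m) (addnC g m) !(addSn, addnS, addn0, add0n, qfactS).
  by field; rewrite !f_neq0 !p_root.
rewrite /top_formula.
apply: (@etrans _ _ (p ^+ e * q ^+ top_exp m 0 g 0 e.+1 * ((1 - p ^+ (g + 2 + m))
  * (1 - p ^+ g.+1) * top_prod m 0 g 0 e.+1) * ((1 - p) ^+ 2 * (1 - q ^+ 4)))).
  by ring.
by rewrite E M; ring.
Qed.

Lemma top_formula_shift_hk a b g e :
  p ^+ (b + e) * (1 - p ^+ a.+1) * (1 - p ^+ (g + b + 2)) * top_formula a b.+1 g 0 e =
  p ^+ a * (1 - p ^+ b.+1) * (1 - p ^+ (g + b + 2 + e)) * top_formula a.+1 b g 0 e.
Proof.
have E : p ^+ (b + e) * q ^+ top_exp a b.+1 g 0 e = p ^+ a * q ^+ top_exp a.+1 b g 0 e.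
  by rewrite !expr2n -!exprD; congr (q ^+ _); rewrite /top_exp; nia.
have M : (1 - p ^+ a.+1) * (1 - p ^+ (g + b + 2)) * top_prod a b.+1 g 0 e =
  (1 - p ^+ b.+1) * (1 - p ^+ (g + b + 2 + e)) * top_prod a.+1 b g 0 e.
  rewrite /top_prod (addnC g b) !(addSn, addnS, addn0, add0n, qfactS).
  by field; rewrite !f_neq0 !p_root.
rewrite /top_formula.
apply: (@etrans _ _ (p ^+ (b + e) * q ^+ top_exp a b.+1 g 0 e * ((1 - p ^+ a.+1)
  * (1 - p ^+ (g + b + 2)) * top_prod a b.+1 g 0 e) * ((1 - p) ^+ 2 * (1 - q ^+ 4)))).
  by ring.
by rewrite E M; ring.
Qed.

Lemma top_formula_E1 a b g d e :
  q ^+ (b.+1 + d + 1) * (1 - p ^+ (g + 1 + b.+1)) * top_formula a b.+1 g d.+1 e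
  + (1 - p ^+ b.+1) * top_formula a.+1 b g d e.+1 = 0.
Proof.
have E : q ^+ (b.+1 + d + 1) * q ^+ top_exp a b.+1 g d.+1 e = q ^+ top_exp a.+1 b g d e.+1.
  by rewrite -!exprD; congr (q ^+ _); rewrite /top_exp; nia.
have M : (1 - p ^+ (g + 1 + b.+1)) * top_prod a b.+1 g d.+1 e =
  (1 - p ^+ b.+1) * top_prod a.+1 b g d e.+1.
  rewrite /top_prod (addnAC g 1%N) (addnC g b.+1) !(addSn, addnS, addn0, add0n, qfactS).
  by field; rewrite !f_neq0 !p_root.
rewrite /top_formula [(-1) ^+ d.+1]exprS.
apply: (@etrans _ _ (q ^+ (b.+1 + d + 1) * q ^+ top_exp a b.+1 g d.+1 e * (-1) ^+ d
  * ((1 - p) ^+ 2 * (1 - q ^+ 4)) * - ((1 - p ^+ (g + 1 + b.+1)) * top_prod a b.+1 g d.+1 e)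
  + (1 - p ^+ b.+1) * top_prod a.+1 b g d e.+1 * (q ^+ top_exp a.+1 b g d e.+1 * (-1) ^+ d
  * ((1 - p) ^+ 2 * (1 - q ^+ 4))))); first by ring.
by rewrite E M; ring.
Qed.

(** The reciprocal of the Weyl dimension (m+1)(n+1)(m+n+2)/2 of SU(3), each integer r being replaced
    by 1 - p^r, normalised by powers of 1 - p. *)
Lemma top_formula_hvec m n : top_formula m 0 n 0 0 =
  (1 - p) ^+ 2 * (1 - p ^+ 2) / ((1 - p ^+ m.+1) * (1 - p ^+ n.+1) * (1 - p ^+ (n + m + 2))).
Proof.
rewrite /top_formula /top_exp /top_prod !(muln0, mul0n, addn0, add0n) expr0 -exprM.
rewrite (addnC n m) !(addSn, addnS, addn0, qfactS) qpoch0.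
by field; rewrite !f_neq0 !p_root.
Qed.

(** Counterpart of [haar_F1], proved for each [j] by [inner_sum_shift] with [D = p ^+ b]. Raising
    [c1] and lowering [c2] by one strips exactly the first factor [1 - Z j] from the q-Pochhammer
    denominator, and this factor is what [inner_sum_shift] supplies, as [Zw] shows. *)
Lemma haar_formula_shift d1 s b c1 r c3 (d2 := (s + b)%N) (c2 := (s + r).+1) :
  q ^+ (r + b + 1 + c2) * (1 - p ^+ (c1 + 1 + b)) * haar_formula d1 d2 c1 c2 c3 s
  + q ^+ c2 * (1 - p ^+ b) * haar_formula d1 d2 c1 c2 c3 s.+1
  = q ^+ (4 + 2 * c1 + 3 * b) * (1 - p ^+ c2) * haar_formula d1 d2 c1.+1 (s + r) c3 s.
Proof.
pose B j := (-1) ^+ j * q ^+ (j ^ 2 - j) * qbinom p d1 j * qbinom p c3 j * qpoch p p j.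
pose Z j := q ^+ (2 * d1 + 2 * d2 + 2 * c1 + 2 * c3 - 2 * j + 4).
pose Q j := qpoch (Z j * p) p c2.
pose w j := q ^+ (2 * d1 + 2 * d2 + 2 * c3 - 2 * j + 2).
pose M j := (d1 + (s + r) + c3 - j)%N.
pose U j := inner_sum p r.+1 c1 (M j).+1 (w j).
pose V j := inner_sum p r c1 (M j).+1 (w j).
pose W j := inner_sum p r c1.+1 (M j) (w j).
have summ_s j : (j < c3.+1)%N -> haar_summand d1 d2 c1 c2 c3 s j = B j / ((1 - Z j) * Q j) * U j.
  move=> jc; rewrite /haar_summand addn1 qpochSl big_mkord.
  have -> : (c2 - s = r.+1)%N by lia.
  congr (_ * _); apply: eq_bigr => i _; rewrite exprM.
  by have -> : (d1 + c2 + c3 - j - i = (M j).+1 - i)%N by rewrite /M; lia.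
have summ_s1 j : (j < c3.+1)%N -> 
    haar_summand d1 d2 c1 c2 c3 s.+1 j = B j / ((1 - Z j) * Q j) * V j.
  move=> jc; rewrite /haar_summand addn1 qpochSl big_mkord.
  have -> : (c2 - s.+1 = r)%N by lia.
  congr (_ * _); apply: eq_bigr => i _; rewrite exprM.
  by have -> : (d1 + c2 + c3 - j - i = (M j).+1 - i)%N by rewrite /M; lia.
have summ_c j : (j < c3.+1)%N -> haar_summand d1 d2 c1.+1 (s + r) c3 s j = B j / Q j * W j.
  move=> jc; rewrite /haar_summand addn1 big_mkord.
  have -> : (s + r - s = r)%N by lia.
  congr (_ * _); last first.
    by apply: eq_bigr => i _; rewrite exprM.
  rewrite /Q /Z -exprD; congr (_ / qpoch (q ^+ _) _ _); lia.
have key j : (j < c3.+1)%N -> (1 - p ^+ (c1 + 1 + b)) * haar_summand d1 d2 c1 c2 c3 s j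
    - (1 - p ^+ b) * haar_summand d1 d2 c1 c2 c3 s.+1 j
  = p ^+ b * haar_summand d1 d2 c1.+1 (s + r) c3 s j.
  move=> jc; rewrite summ_s // summ_s1 // summ_c //.
  have Zw : p ^+ c1.+1 * w j = Z j.
    by rewrite /w /Z expr2n -exprD; congr (q ^+ _); lia.
  have Zn n : 1 - Z j * p ^+ n != 0.
    rewrite (_ : Z j * p ^+ n = p ^+ (d1 + d2 + c1 + c3 - j + 1 + n).+1) //.
    by rewrite /Z !expr2n -exprD; congr (q ^+ _); lia.
  have Z0 : 1 - Z j != 0 by have := Zn 0%N; rewrite expr0 mulr1.
  have Q0 : Q j != 0.
    by rewrite /Q -[p]expr1; apply: (qpochz_neq0 Zn).
  have rM : (r <= M j)%N by rewrite /M; lia.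
  have wM : w j * p ^+ r = p ^+ b * p ^+ (M j).+1.
    by rewrite /w !expr2n -!exprD; congr (q ^+ _); rewrite /M; lia.
  have := inner_sum_shift p_neq0 p_root c1 rM wM.
  rewrite -[p ^+ c1.+1 * p ^+ b]exprD Zw -/(U j) -/(V j) -/(W j) => step.
  rewrite addn1; apply: subr0_inj.
  apply: (etrans _ (mulr0 (B j / ((1 - Z j) * Q j)))).
  by rewrite -(eq_subr0 step); field; rewrite Q0 Z0.
have pref : haar_prefactor d1 d2 c1 c2 c3 = (1 - p ^+ c2) * haar_prefactor d1 d2 c1.+1 (s + r) c3.
  rewrite /haar_prefactor qfactS (_ : (c1 + c2 + c3 + 1 = c1.+1 + (s + r) + c3 + 1)%N); last by lia.
  by ring.
rewrite /haar_formula pref !big_mkord.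
set S0 := \sum_(j < _) _; set S1 := \sum_(j < _) _; set S2 := \sum_(j < _) _.
have sum_key : (1 - p ^+ (c1 + 1 + b)) * S0 - (1 - p ^+ b) * S1 = p ^+ b * S2.
  by rewrite !mulr_sumr -sumrB; apply: eq_bigr => j _; apply: key.
have -> : (d2 + c2 - s + 1 = s + b + r + 2)%N by lia.
have -> : (d2 + c2 - s.+1 + 1 = s + b + r + 1)%N by lia.
have -> : (d2 + (s + r) - s + 1 = s + b + r + 1)%N by lia.
set X0 := (_ + s * _)%N; set X1 := (_ + s.+1 * _)%N; set X2 := (_ + s * _)%N.
have E1 : q ^+ c2 * q ^+ X1 = q ^+ (r + b + 1 + c2) * q ^+ X0.
  by rewrite -!exprD; congr (q ^+ _); rewrite /X1 /X0; lia.
have E2 : q ^+ (4 + 2 * c1 + 3 * b) * q ^+ X2 = q ^+ (r + b + 1 + c2) * q ^+ X0 * p ^+ b.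
  by rewrite expr2n -!exprD; congr (q ^+ _); rewrite /X2 /X0; nia.
set P := haar_prefactor _ _ _ _ _; rewrite [(-1) ^+ s.+1]exprS; apply: subr0_inj.
pose t := (-1) ^+ s * (1 - p ^+ c2) * P.
apply: (etrans _ (lincomb3_eq0 (- (1 - p ^+ b) * t * S1) (- t * S2)
  (q ^+ (r + b + 1 + c2) * q ^+ X0 * t)
  (eq_subr0 E1) (eq_subr0 E2) (eq_subr0 sum_key))).
by rewrite /t; ring.
Qed.

(** * The recursions determine the Gram entries *)

Section Gram.
Variable G : nat -> nat -> nat -> nat -> nat -> nat -> nat -> nat -> nat -> nat -> K.
Hypothesis G_F1 : forall a b g d e a' b' g' d' e',
  q ^+ (d + b + 1 + d') * (1 - p ^+ (g + 1 + b)) * G a b g d.+1 e a' b' g' d' e'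
  + q ^+ d' * (1 - p ^+ b) * G a.+1 b.-1 g d e.+1 a' b' g' d' e'
  = q ^+ (4 + 2 * g + 3 * b) * (1 - p ^+ d') * G a b g.+1 d e a' b' g'.+1 d'.-1 e'.
Hypothesis G_E1 : forall a' b' g' e' a b g d e,
  q ^+ (b + d + 1) * (1 - p ^+ (g + 1 + b)) * G a' b' g' 0 e' a b g d.+1 e
  + (1 - p ^+ b) * G a' b' g' 0 e' a.+1 b.-1 g d e.+1 = 0.
Hypothesis G_hk : forall a b g e,
  p ^+ (b + e) * (1 - p ^+ a.+1) * (1 - p ^+ (g + b + 2)) * G a b.+1 g 0 e a b.+1 g 0 e =
  p ^+ a * (1 - p ^+ b.+1) * (1 - p ^+ (g + b + 2 + e)) * G a.+1 b g 0 e a.+1 b g 0 e.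
Hypothesis G_c : forall m g e,
  p ^+ e * (1 - p ^+ (g + 2 + m)) * (1 - p ^+ g.+1) * G m 0 g 0 e.+1 m 0 g 0 e.+1 =
  p ^+ (2 + g + m) * (1 - p ^+ e.+1) * (1 - p ^+ (g + 2)) * G m 0 g.+1 0 e m 0 g.+1 0 e.
Hypothesis G_x : forall m n,
  (1 - p ^+ n.+1) * (1 - p ^+ (n + m + 2)) * G m 0 n 0 0 m 0 n 0 0 =
  (1 - p ^+ (n + 2)) * (1 - p ^+ (n + m + 3)) * G m 0 n.+1 0 0 m 0 n.+1 0 0.
Hypothesis G_u : forall m,
  (1 - p ^+ m.+1) * G m 0 0 0 0 m 0 0 0 0 =
  (1 - p ^+ (m + 3)) * G m.+1 0 0 0 0 m.+1 0 0 0 0.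
Hypothesis G_1 : G 0 0 0 0 0 0 0 0 0 0 = 1.

Lemma p_root_pos n : (0 < n)%N -> 1 - p ^+ n != 0.
Proof. by case: n. Qed.

Lemma gram_hvec m n : G m 0 n 0 0 m 0 n 0 0 = top_formula m 0 n 0 0.
Proof.
elim: n => [|n ih].
  elim: m => [|m ih].
    rewrite G_1 top_formula_hvec expr1 add0n; have := p_root 0; have := p_root 1.
    by rewrite expr1 => p2 p1; field; rewrite p1 p2.
  have nz : 1 - p ^+ (m + 3) != 0 by apply: p_root_pos; lia.
  apply: (mulfI nz); rewrite -G_u ih !top_formula_hvec !add0n !addSn !addnS addn0 expr1.
  have := p_root 0; rewrite expr1 => p1.
  by field; rewrite p1 !p_root.
have nz : (1 - p ^+ (n + 2)) * (1 - p ^+ (n + m + 3)) != 0.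
  by rewrite mulf_neq0 // p_root_pos //; lia.
apply: (mulfI nz); rewrite -G_x ih !top_formula_hvec !addSn !addnS !addn0.
by field; rewrite !p_root.
Qed.

Lemma gram_c m g e : G m 0 g 0 e m 0 g 0 e = top_formula m 0 g 0 e.
Proof.
elim: e g => [|e ih] g; first exact: gram_hvec.
have nz : p ^+ e * (1 - p ^+ (g + 2 + m)) * (1 - p ^+ g.+1) != 0.
  by rewrite !mulf_neq0 ?expf_neq0 ?p_root_pos //; lia.
by apply: (mulfI nz); rewrite G_c ih -top_formula_shift_c.
Qed.

Lemma gram_hk a b g e : G a b g 0 e a b g 0 e = top_formula a b g 0 e.
Proof.
elim: b a => [|b ih] a; first exact: gram_c.
have nz : p ^+ (b + e) * (1 - p ^+ a.+1) * (1 - p ^+ (g + b + 2)) != 0.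
  by rewrite !mulf_neq0 ?expf_neq0 ?p_root_pos //; lia.
by apply: (mulfI nz); rewrite G_hk ih -top_formula_shift_hk.
Qed.

(** Starting from the diagonal, each use of [G_E1] keeps the left word and replaces one [v2] and one
    [y2] of the right word by [v1] and [y1]. *)
Lemma gram_top a b g d e :
  G (a + d) b g 0 (e + d) a (b + d) g d e = top_formula a (b + d) g d e.
Proof.
elim: d a e => [|d ih] a e; first by rewrite !addn0 gram_hk.
have nz : q ^+ ((b + d).+1 + d + 1) * (1 - p ^+ (g + 1 + (b + d).+1)) != 0.
  by rewrite mulf_neq0 ?expf_neq0 ?p_root_pos //; lia.
rewrite (addnS a) (addnS b) (addnS e); apply: (mulfI nz).
have := G_E1 (a + d).+1 b g (e + d).+1 a (b + d).+1 g d e.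
have := top_formula_E1 a (b + d) g d e.
rewrite -[(a + d).+1]addSn -[(e + d).+1]addSn /= ih => <- /eqP.
by rewrite (can_eq (addrK _)) => /eqP.
Qed.

(** Induction on [r], which is c_2 - k. The other two entries in [G_F1] have the smaller [r], one
    with [s + 1] and [b - 1], the other with [c1 + 1]; hence [s], [b] and [c1] are generalised. *)
Lemma gram_formula d1 s b c1 r c3 :
  G (d1 + s) b c1 r (c3 + s) d1 (s + b) c1 (s + r) c3
  = haar_formula d1 (s + b) c1 (s + r) c3 s.
Proof.
elim: r s b c1 => [|r ih] s b c1.
  by rewrite addn0 haar_formula_top [(s + b)%N]addnC gram_top.
have nz : q ^+ (r + b + 1 + (s + r).+1) * (1 - p ^+ (c1 + 1 + b)) != 0.
  by rewrite mulf_neq0 ?expf_neq0 ?p_root_pos //; lia.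
rewrite (addnS s r); apply: (mulfI nz).
have := G_F1 (d1 + s) b c1 r (c3 + s) d1 (s + b) c1 (s + r).+1 c3.
rewrite /= ih -haar_formula_shift.
suff -> : q ^+ (s + r).+1 * (1 - p ^+ b) *
    G (d1 + s).+1 b.-1 c1 r (c3 + s).+1 d1 (s + b) c1 (s + r).+1 c3
  = q ^+ (s + r).+1 * (1 - p ^+ b) * haar_formula d1 (s + b) c1 (s + r).+1 c3 s.+1.
  by move/eqP; rewrite (can_eq (addrK _)) => /eqP.
case: b {nz} => [|b]; first by rewrite expr0 subrr mulr0 !mul0r.
by rewrite /= -!addnS -[(s + b.+1)%N]addSnnS -[(s + r.+1)%N]addSnnS ih.
Qed.

End Gram.
End Formula.

(** * Rows and minors of the quantum matrix *)

Section Rows.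
Variables (R : realType) (q : R).
Hypothesis q_neq0 : q != 0.
Local Notation C := R[i].
Local Notation Q := (q%:C)%C.
Local Notation A := (OGLq q).
Local Notation g := (@gen R q).
Variable Delta : {lrmorphism A -> tensor A A}.
Hypothesis HDelta : is_comul Delta.
Variable haar : {scalar A}.
Hypothesis Hhaar : is_haar_state Delta haar.
Variables (star : A -> A) (Hstar : is_star star).

Fact adjacent10 : adjacent 1 0. Proof. by []. Qed.
Fact adjacent21 : adjacent 2 1. Proof. by []. Qed.
Fact adjacent01 : adjacent 0 1. Proof. by []. Qed.

Local Notation F1 := (act q_neq0 Delta adjacent10).
Local Notation F2 := (act q_neq0 Delta adjacent21).
Local Notation E1 := (act q_neq0 Delta adjacent01).

Lemma act_twisted (a b : 'I_3) (ab : adjacent a b) :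
  twisted_derivation haar (act q_neq0 Delta ab).
Proof.
split.
- by move=> *; apply: act_mul.
- exact: act1.
- by move=> x y z; apply: haar_act.
Qed.

Lemma cominorE i (j : 'I_3) : cominor q i j =
  g (lift i 0) (lift j 0) * g (lift i 1) (lift j 1)
  - Q *: (g (lift i 0) (lift j 1) * g (lift i 1) (lift j 0)).
Proof. exact: xi2E. Qed.

Lemma lift3 : ((lift (0 : 'I_3) (0 : 'I_2) = 1) * (lift (0 : 'I_3) (1 : 'I_2) = 2)
  * (lift (1 : 'I_3) (0 : 'I_2) = 0) * (lift (1 : 'I_3) (1 : 'I_2) = 2)
  * (lift (2 : 'I_3) (0 : 'I_2) = 0) * (lift (2 : 'I_3) (1 : 'I_2) = 1))%type.
Proof. by do !split; apply/val_inj. Qed.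

Lemma root_weightE :
  (root_weight q 1 0 0 = Q^-1) * (root_weight q 1 0 1 = Q) * (root_weight q 1 0 2 = 1)
  * (root_weight q 0 1 0 = Q^-1) * (root_weight q 0 1 1 = Q) * (root_weight q 0 1 2 = 1)
  * (root_weight q 2 1 0 = 1) * (root_weight q 2 1 1 = Q^-1) * (root_weight q 2 1 2 = Q).
Proof. by []. Qed.

Lemma gen_row_vector i : row_vector Q F1 F2 E1 (g i 0) (g i 1) (g i 2).
Proof.
have a1 := act_gen q_neq0 HDelta adjacent10 i.
have a2 := act_gen q_neq0 HDelta adjacent21 i.
have a3 := act_gen q_neq0 HDelta adjacent01 i.
split; try exact: gen_row.
- by have := a1 0; rewrite root_weightE.
- by have := a1 1; rewrite root_weightE.
- by have := a1 2; rewrite root_weightE.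
- by have := a2 0; rewrite root_weightE.
- by have := a2 1; rewrite root_weightE.
- by have := a2 2; rewrite root_weightE.
- by have := a3 0; rewrite root_weightE.
- by have := a3 1; rewrite root_weightE.
- by have := a3 2; rewrite root_weightE.
Qed.

Lemma act_cominor (a b : 'I_3) (ab : adjacent a b) i j :
  act q_neq0 Delta ab (cominor q i j)
    (g (lift i 0) (lift j 0) * (if lift j 1 == b then g (lift i 1) a else 0)
     + (if lift j 0 == b then g (lift i 0) a else 0)
       * (root_weight q a b (lift j 1) *: g (lift i 1) (lift j 1))
     - Q *: (g (lift i 0) (lift j 1) * (if lift j 0 == b then g (lift i 1) a else 0)
       + (if lift j 1 == b then g (lift i 0) a else 0)
         * (root_weight q a b (lift j 0) *: g (lift i 1) (lift j 0))))
    ((root_weight q a b (lift j 0) * root_weight q a b (lift j 1)) *: cominor q i j).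
Proof.
have a_ := act_gen q_neq0 HDelta ab.
rewrite cominorE.
have := act_sub (act_mul (a_ (lift i 0) (lift j 0)) (a_ (lift i 1) (lift j 1)))
  (act_scale Q (act_mul (a_ (lift i 0) (lift j 1)) (a_ (lift i 1) (lift j 0)))).
congr act; rewrite scalerBr -!scalerAl -!scalerAr !scalerA.
by congr (_ *: _ - _ *: _); ring.
Qed.

Ltac simp := rewrite ?(mulr0, mul0r, addr0, add0r, scaler0, oppr0, scale1r) -?scalerAr
  ?scalerA ?mulfV ?scale1r ?subrr ?fmorph_eq0 //.

(** Only the action is computed from the minors. Their q-commutation is a hypothesis because for
    [star] of a row it follows at once from the row relations. The scalar [c] absorbs the (-q)^(-i)
    of [star_gen]. *)
Lemma cominor_covector i (c : C) :
  let w0 := c *: (cominor q i 0 * detinv) in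
  let w1 := (c * - Q) *: (cominor q i 1 * detinv) in
  let w2 := (c * Q ^+ 2) *: (cominor q i 2 * detinv) in
  w1 * w0 = Q *: (w0 * w1) -> w2 * w0 = Q *: (w0 * w2) -> w2 * w1 = Q *: (w1 * w2) ->
  row_covector Q F1 F2 E1 w0 w1 w2.
Proof.
move=> w0 w1 w2 c10 c20 c21.
have Q0 : Q != 0 by rewrite fmorph_eq0.
have D (a b : 'I_3) (ab : adjacent a b) j k l l' y y' :
    act q_neq0 Delta ab (cominor q i j) y (l *: cominor q i j) ->
    k *: (y * detinv) = y' -> l = l' ->
    act q_neq0 Delta ab (k *: (cominor q i j * detinv)) y' (l' *: (k *: (cominor q i j * detinv))).
  move=> dj <- <-; have := act_scale k (act_mul dj (act_detinv q_neq0 HDelta ab)).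
  by rewrite mulr0 add0r -scalerAl !scalerA [l * k]mulrC.
split=> //.
- apply: (@D _ _ _ _ _ _ _ _ _ (act_cominor adjacent10 i 0));
    rewrite !lift3 !root_weightE /= ?mulr1 //.
  by simp; rewrite ?mul0r ?scaler0.
- apply: (@D _ _ _ _ _ _ _ _ _ (act_cominor adjacent10 i 1));
    rewrite !lift3 !root_weightE /= ?mulr1 //.
  by simp; rewrite [cominor q i 0]cominorE !lift3 mulrC.
- apply: (@D _ _ _ _ _ _ _ _ _ (act_cominor adjacent10 i 2));
    rewrite !lift3 !root_weightE /= ?mulVf //.
  by simp; rewrite ?mul0r ?scaler0.
- apply: (@D _ _ _ _ _ _ _ _ _ (act_cominor adjacent21 i 0));
    rewrite !lift3 !root_weightE /= ?mulVf //.
  by simp; rewrite ?mul0r ?scaler0.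
- apply: (@D _ _ _ _ _ _ _ _ _ (act_cominor adjacent21 i 1));
    rewrite !lift3 !root_weightE /= ?mul1r //.
  by simp; rewrite ?mul0r ?scaler0.
- apply: (@D _ _ _ _ _ _ _ _ _ (act_cominor adjacent21 i 2));
    rewrite !lift3 !root_weightE /= ?mul1r //.
  simp; rewrite [cominor q i 1]cominorE !lift3 ?scalerA; congr (_ *: _); ring.
- apply: (@D _ _ _ _ _ _ _ _ _ (act_cominor adjacent01 i 0));
    rewrite !lift3 !root_weightE /= ?mulr1 //.
  simp; rewrite [cominor q i 1]cominorE !lift3 ?scalerA; congr (_ *: _); by field.
- apply: (@D _ _ _ _ _ _ _ _ _ (act_cominor adjacent01 i 1));
    rewrite !lift3 !root_weightE /= ?mulr1 //.
  by simp; rewrite ?mul0r ?scaler0.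
apply: (@D _ _ _ _ _ _ _ _ _ (act_cominor adjacent01 i 2));
  rewrite !lift3 !root_weightE /= ?mulVf //.
by simp; rewrite ?mul0r ?scaler0.
Qed.

Lemma starZ_real (r : R) x : star ((r%:C)%C *: x) = (r%:C)%C *: star x.
Proof. by rewrite (starZ Hstar); congr (_ *: _); exact: conjc_real. Qed.

Lemma star_row_comm (i j k : 'I_3) : (j < k)%N ->
  star (g i k) * star (g i j) = Q *: (star (g i j) * star (g i k)).
Proof.
by move=> jk; rewrite -(starM Hstar) (gen_row q i jk) starZ_real (starM Hstar).
Qed.

Lemma star_gen_row0 :
  [/\ star (g 0 0) = 1 *: (cominor q 0 0 * detinv),
      star (g 0 1) = (1 * - Q) *: (cominor q 0 1 * detinv)
    & star (g 0 2) = (1 * Q ^+ 2) *: (cominor q 0 2 * detinv)].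
Proof.
split; rewrite (star_gen Hstar) //=; congr (_ *: _); rewrite ?mul1r //.
- by rewrite /= expr1z rmorphN.
by rewrite -[Posz 2 - _]/(Posz 2) -exprnP sqrrN rmorphXn.
Qed.

Lemma star_gen_row2 :
  [/\ star (g 2 0) = (Q ^- 2) *: (cominor q 2 0 * detinv),
      star (g 2 1) = (Q ^- 2 * - Q) *: (cominor q 2 1 * detinv)
    & star (g 2 2) = (Q ^- 2 * Q ^+ 2) *: (cominor q 2 2 * detinv)].
Proof.
have Q0 : Q != 0 by rewrite fmorph_eq0.
split; rewrite (star_gen Hstar) //=; congr (_ *: _).
- by rewrite -[_ - _]/(- Posz 2) -exprnN sqrrN fmorphV rmorphXn.
- rewrite -[_ - _]/(- Posz 1) -exprnN expr1 fmorphV rmorphN; field.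
  by rewrite Q0.
by rewrite -[_ - _]/(Posz 0) expr0z mulVf ?expf_neq0.
Qed.

Lemma star_covector0 : row_covector Q F1 F2 E1 (star (g 0 0)) (star (g 0 1)) (star (g 0 2)).
Proof.
have [e0 e1 e2] := star_gen_row0.
by rewrite e0 e1 e2; apply: cominor_covector; rewrite -?e0 -?e1 -?e2; apply: star_row_comm.
Qed.

Lemma star_covector2 : row_covector Q F1 F2 E1 (star (g 2 0)) (star (g 2 1)) (star (g 2 2)).
Proof.
have [e0 e1 e2] := star_gen_row2.
by rewrite e0 e1 e2; apply: cominor_covector; rewrite -?e0 -?e1 -?e2; apply: star_row_comm.
Qed.

(** Laplace expansion of the quantum determinant along the first row, with the minors on the
    right. *)
Lemma contract_row0 : g 0 0 * star (g 0 0) + g 0 1 * star (g 0 1) + g 0 2 * star (g 0 2) = 1.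
Proof.
have [-> -> ->] := star_gen_row0.
rewrite -!scalerAr !mulrA !scalerAl -!mulrDl -(qdet_detinv q); congr (_ * _).
rewrite qdet3E !cominorE !lift3 !mul1r scale1r !mulrBr.
rewrite -?scalerAr -?scalerAl -?scalerAr ?scalerA ?mulrA.
rewrite -!expr2 -exprSr mulrN !scaleNr opprK !addrA.
by rewrite [LHS](ACl (1*3*2*6*5*4))%AC.
Qed.

Lemma detinvC (x : A) i j : x * detinv * g i j = x * g i j * detinv.
Proof. by rewrite -!mulrA (detinv_central q i j). Qed.

(** Laplace expansion along the last row with the minors on the left. Its signs are (-q)^(2-j),
    those in [star] are (-q)^(j-2); their quotient is the weight q^(2(2-j)). *)
Lemma contract_row2 : Q ^+ 4 *: (star (g 2 0) * g 2 0) + Q ^+ 2 *: (star (g 2 1) * g 2 1)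
  + star (g 2 2) * g 2 2 = 1.
Proof.
have Q0 : Q != 0 by rewrite fmorph_eq0.
have [-> -> ->] := star_gen_row2.
rewrite -!scalerAl !detinvC !scalerA !scalerAl -!mulrDl -(qdet_detinv q); congr (_ * _).
have -> : Q ^+ 4 / Q ^+ 2 = Q ^+ 2 by field.
have -> : Q ^+ 2 * (Q ^- 2 * - Q) = - Q by field.
rewrite mulVf ?expf_neq0 // scale1r.
rewrite qdet3E !cominorE !lift3 !scalerBr ?scalerA !mulrBl -?scalerAl ?scalerA.
rewrite -exprSr mulNr !scaleNr opprK -expr2 !addrA.
by rewrite [LHS](ACl (5*6*3*2*4*1))%AC.
Qed.

(** The same expansion with the last row replaced by the first: a quantum determinant with a
    repeated row vanishes. *)
Lemma contract_row20 : Q ^+ 4 *: (star (g 2 0) * g 0 0) + Q ^+ 2 *: (star (g 2 1) * g 0 1)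
  + star (g 2 2) * g 0 2 = 0.
Proof.
have Q0 : Q != 0 by rewrite fmorph_eq0.
have [-> -> ->] := star_gen_row2.
rewrite -!scalerAl !detinvC !scalerA !scalerAl -!mulrDl -[RHS](mul0r detinv); congr (_ * _).
have -> : Q ^+ 4 / Q ^+ 2 = Q ^+ 2 by field.
have -> : Q ^+ 2 * (Q ^- 2 * - Q) = - Q by field.
rewrite mulVf ?expf_neq0 // scale1r.
pose l := Q - Q^-1.
have c112 : g 1 1 * g 0 2 = g 0 2 * g 1 1 by rewrite (@gen_antidiag _ q 0 1 1 2).
have c102 : g 1 0 * g 0 2 = g 0 2 * g 1 0 by rewrite (@gen_antidiag _ q 0 1 0 2).
have c101 : g 1 0 * g 0 1 = g 0 1 * g 1 0 by rewrite (@gen_antidiag _ q 0 1 0 1).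
have c121 : g 1 2 * g 0 1 = g 0 1 * g 1 2 - l *: (g 0 2 * g 1 1).
  by rewrite (@gen_diag _ q 0 1 1 2) // (QV_sub q) addrK.
have c120 : g 1 2 * g 0 0 = g 0 0 * g 1 2 - l *: (g 0 2 * g 1 0).
  by rewrite (@gen_diag _ q 0 1 0 2) // (QV_sub q) addrK.
have c110 : g 1 1 * g 0 0 = g 0 0 * g 1 1 - l *: (g 0 1 * g 1 0).
  by rewrite (@gen_diag _ q 0 1 0 1) // (QV_sub q) addrK.
have r10 : g 0 1 * g 0 0 = Q^-1 *: (g 0 0 * g 0 1) by apply: qcomm_sym Q0 (gen_row q 0 _).
have r20 : g 0 2 * g 0 0 = Q^-1 *: (g 0 0 * g 0 2) by apply: qcomm_sym Q0 (gen_row q 0 _).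
have r21 : g 0 2 * g 0 1 = Q^-1 *: (g 0 1 * g 0 2) by apply: qcomm_sym Q0 (gen_row q 0 _).
(* The ordered monomials to which the three products reduce; their coefficients then cancel. *)
pose P := g 0 0 * g 0 2 * g 1 1; pose S := g 0 0 * g 0 1 * g 1 2.
pose U := g 0 1 * g 0 2 * g 1 0.
have e2 : cominor q 2 2 * g 0 2 = P - Q *: U.
  by rewrite cominorE !lift3 mulrBl -scalerAl -!mulrA c112 c102 !mulrA.
have e1 : cominor q 2 1 * g 0 1 = S - l *: P - U.
  rewrite cominorE !lift3 mulrBl -scalerAl -!mulrA c121 c101 mulrBr -scalerAr !mulrA r21.
  by rewrite -scalerAl scalerA mulfV // scale1r.
have e0 : cominor q 2 0 * g 0 0 = Q^-1 *: S - P.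
  rewrite cominorE !lift3 mulrBl -scalerAl -!mulrA c120 c110 !mulrBr -!scalerAr !mulrA r10 r20 r21.
  rewrite scalerBr -!scalerAl !scalerA mulfV // scale1r.
  by rewrite (_ : Q * l / Q = l) ?opprB ?addrA ?subrK //; field.
rewrite -!scalerAl e0 e1 e2 !scalerBr !scalerA.
have -> : Q ^+ 2 / Q = Q by field.
have -> : - Q * l = 1 - Q ^+ 2 by rewrite /l; field.
rewrite scalerBl scale1r !scaleNr !opprB !opprK !addrA.
rewrite [LHS](ACl ((1*3)*(2*4)*(5*7)*(6*8)))%AC /=.
by rewrite !subrr !addNr !addr0.
Qed.

Lemma contract_row02 : Q ^+ 4 *: (star (g 0 0) * g 2 0) + Q ^+ 2 *: (star (g 0 1) * g 2 1)
  + star (g 0 2) * g 2 2 = 0.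
Proof.
have star0 : star 0 = 0 by have := starD Hstar 0 0; rewrite addr0 -[LHS]addr0 => /addrI <-.
have starX n x : star (Q ^+ n *: x) = Q ^+ n *: star x by rewrite -!rmorphXn starZ_real.
have := congr1 star contract_row20.
by rewrite star0 !(starD Hstar) !starX !(starM Hstar) !(starK Hstar).
Qed.

End Rows.

(** * From real to complex scalars, and conclusion *)

Section FormulaMorphism.
Variables (F G : fieldType) (phi : {rmorphism F -> G}).

Lemma qpoch_rmorph x y n : phi (qpoch x y n) = qpoch (phi x) (phi y) n.
Proof.
rewrite /qpoch rmorph_prod; apply: eq_bigr => i _.
by rewrite rmorphB rmorph1 rmorphM rmorphXn.
Qed.

Lemma qbinom_rmorph x n j : phi (qbinom x n j) = qbinom (phi x) n j.
Proof.
rewrite /qbinom; case: ifP => _; last by rewrite rmorph0.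
by rewrite fmorph_div rmorphM /= !qpoch_rmorph.
Qed.

Lemma haar_formula_rmorph q d1 d2 c1 c2 c3 k :
  phi (haar_formula q d1 d2 c1 c2 c3 k) = haar_formula (phi q) d1 d2 c1 c2 c3 k.
Proof.
have push := (@rmorphXn _ _ phi, qpoch_rmorph, qbinom_rmorph, rmorphN1,
  @rmorphM _ _ phi, @fmorphV _ _ phi).
rewrite /haar_formula /haar_prefactor !push rmorphB rmorph1 !push rmorphB rmorph1 !push.
congr (_ * _); rewrite rmorph_sum; apply: eq_bigr => j _.
rewrite /haar_summand !push; congr (_ * _); rewrite rmorph_sum; apply: eq_bigr => i _.
by rewrite !push.
Qed.

End FormulaMorphism.

Local Open Scope complex_scope.

(** Since [q] is real, [q ^+ 2] is nonnegative, and a positive power of it equals 1 only if it does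
    itself. *)
Lemma sub1_sqrX_neq0 (R : realType) (q : R) n :
  q != 0 -> q != 1 -> q != -1 -> 1 - (q%:C ^+ 2) ^+ n.+1 != 0.
Proof.
move=> q0 q1 qN1; rewrite -!rmorphXn -(rmorph1 (real_complex R)) -rmorphB fmorph_eq0.
by rewrite subr_eq0 eq_sym pexpr_eq1 ?sqr_ge0 //= sqrf_eq1 negb_or q1.
Qed.
Theorem proposition5p6 (R : realType) (q : R)
  (q_neq0 : q != 0) (q_neq1 : q != 1) (q_neqN1 : q != -1)
  (Delta : {lrmorphism OGLq q -> tensor (OGLq q) (OGLq q)})
  (HDelta : is_comul Delta)
  (star : OGLq q -> OGLq q) (Hstar : is_star star)
  (haar : {scalar OGLq q}) (Hhaar : is_haar_state Delta haar)
  (d1 d2 c1 c2 c3 k : nat) (Hk : (k <= minn d2 c2)%N) :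
  let xa : OGLq q := gen 0 0 in
  let xb : OGLq q := gen 0 1 in
  let xc : OGLq q := gen 0 2 in
  let xh : OGLq q := gen 2 1 in
  let xk : OGLq q := gen 2 2 in
  haar (star xk ^+ (d1 + k) * star xh ^+ (d2 - k)
        * xa ^+ c1 * xb ^+ (c2 - k) * xc ^+ (c3 + k)
        * star xc ^+ c3 * star xb ^+ c2 * star xa ^+ c1
        * xh ^+ d2 * xk ^+ d1)
  = ((-1) ^+ k
     * q ^+ (2 * d1 * d2 + 2 * c1 * c2 + 2 * c1 * c3 + 2 * c2 * c3
             + 2 * c2 + 4 * c3 + k * (d2 + c2 - k + 1))
     * ((1 - q ^+ 2) ^+ 2 * (1 - q ^+ 4)
        * qpoch (q ^+ 2) (q ^+ 2) d2 * qpoch (q ^+ 2) (q ^+ 2) c2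
        / (qpoch (q ^+ 2) (q ^+ 2) (d1 + d2 + 1)%N
           * qpoch (q ^+ 2) (q ^+ 2) (c1 + c2 + c3 + 1)%N))
     * \sum_(0 <= j < c3.+1)
         ((-1) ^+ j * q ^+ (j ^ 2 - j)
          * qbinom (q ^+ 2) d1 j * qbinom (q ^+ 2) c3 j
          * qpoch (q ^+ 2) (q ^+ 2) j
          / qpoch (q ^+ (2 * d1 + 2 * d2 + 2 * c1 + 2 * c3 - 2 * j + 4))
                  (q ^+ 2) (c2 + 1)%N
          * \sum_(0 <= i < (c2 - k).+1)
              (q ^+ ((2 * d1 + 2 * d2 + 2 * c3 - 2 * j + 2) * i)
               * qpoch (q ^+ 2) (q ^+ 2) (c1 + i)%N
               * qpoch (q ^+ 2) (q ^+ 2) (d1 + c2 + c3 - j - i)%N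
               * qbinom (q ^+ 2) (c2 - k)%N i)))%:C.
Proof.
move=> xa xb xc xh xk.
have Q0 : q%:C != 0 by rewrite fmorph_eq0.
have p_root n := sub1_sqrX_neq0 n q_neq0 q_neq1 q_neqN1.
have p_neq1 : q%:C ^+ 2 != 1 by have := p_root 0%N; rewrite expr1 subr_eq0 eq_sym.
have HF1 := act_twisted q_neq0 Hhaar adjacent10.
have HF2 := act_twisted q_neq0 Hhaar adjacent21.
have HE1 := act_twisted q_neq0 Hhaar adjacent01.
have Hx := gen_row_vector q_neq0 HDelta 0.
have Hv := gen_row_vector q_neq0 HDelta 2.
have Hy := star_covector0 q_neq0 HDelta Hstar.
have Hu := star_covector2 q_neq0 HDelta Hstar.
have ux := contract_row20 q_neq0 Hstar.
have yv := contract_row02 q_neq0 Hstar.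
have xy := contract_row0 Hstar.
have uv := contract_row2 q_neq0 Hstar.
pose G a b g d e a' b' g' d' e' :=
  haar (lword xa xb xc (star xh) (star xk) a b g d e
    * rword (star xa) (star xb) (star xc) xh xk a' b' g' d' e').
have [kd kc] : (k <= d2 /\ k <= c2)%N by move: Hk; rewrite leq_min => /andP.
have G1 : G 0%N 0%N 0%N 0%N 0%N 0%N 0%N 0%N 0%N 0%N = 1.
  by rewrite /G /lword /rword !expr0 !mulr1 (haar1 Hhaar).
(* Here [s = k], [b = d2 - k] and [r = c2 - k]; the bound on [k] restores [d2] and [c2] from the
   truncated differences. *)
have := @gram_formula _ q%:C Q0 p_root G (haar_F1 HF1 Q0 Hx Hv Hy Hu ux p_neq1)
  (haar_E1 HE1 Q0 Hx Hv Hy Hu yv p_neq1) (haar_shift_hk HF2 HE1 Q0 Hx Hv Hy Hu yv p_neq1)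
  (haar_shift_c HF1 HF2 Q0 Hx Hv Hy Hu ux p_neq1) (hvec_recx HF1 HF2 Q0 Hx Hv Hy Hu ux xy p_neq1)
  (fun m => hvec_recu HF1 HF2 HE1 Q0 Hx Hv Hy Hu yv uv p_neq1 m (p_root 1%N))
  G1 d1 k (d2 - k)%N c1 (c2 - k)%N c3.
rewrite !subnKC // -haar_formula_rmorph => <-.
by rewrite /G /lword /rword !mulrA.
Qed.
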